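(* There exists a $k$-player algorithm that, given $$O\left(\frac{1}{\sqrt k}\cdot\sum_{i=2}^n\frac1{\Delta_i^2}\,\log\frac n{\Delta_i}\,\log\frac1\delta\right)$$ arm pulls per player, identifies the best arm correctly with probability at least $1-\delta$. The algorithm uses a single communication round, in which each player communicates $O(\log(1/\delta))$ numerical values.
   Context: There are $k\ge1$ players and $n$ arms. Each pull of arm $i$ by a player yields an independent sample of a $[0,1]$-valued reward with unknown expectation $p_i$. For convenience of notation, arms are ordered so that $p_1\ge p_2\ge\dots\ge p_n$ (the players do not know this order), and $\Delta_i:=p_1-p_i$. The best arm is the arm with maximal expected reward; it is assumed to be unique, so $\Delta_i>0$ for $i\ge2$. Here $\delta>0$ is any given target confidence level. In a $k$-player algorithm, at every time step each player pulls one arm of its choice, regardless of the other players, and observes the reward. In a communication round each player broadcasts a message to all other players; here the single round takes place at the end, after all arm pulls. At the end each player must commit to a single arm, and the algorithm identifies the best arm correctly if all players commit to it. *)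

(* Defs.v *)
From HB Require Import structures.
From mathcomp Require Export all_boot all_order all_algebra.
From mathcomp Require Export all_classical all_reals all_analysis.
Export Order.TTheory GRing.Theory Num.Theory numFieldNormedType.Exports.

Set Implicit Arguments.
Unset Strict Implicit.
Unset Printing Implicit Defensive.

Local Open Scope classical_set_scope.
Local Open Scope ring_scope.

(* The arms already pulled by a player, with the observed rewards, oldest
   first. *)
Definition observations (R : realType) (n : nat) : Type := seq ('I_n * R).

(* A randomized k-player algorithm with n arms whose only communication round
   takes place after all the pulls and consists of m real numbers per player.
   Player j draws a private seed with law [seed_law j], independently of the
   other players and of the rewards.  What player j does depends only on j, on
   its seed, on its own observations and, in [commit], on the m values
   broadcast by each of the players.  The parameters of an algorithm do not
   include the mean rewards, nor the order of the arms by mean reward. *)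
Record algorithm (R : realType) (k n m : nat) := Algorithm {
  seed : finType ;
  seed_law : 'I_k -> seed -> R ;
  seed_law_ge0 : forall j u, 0 <= seed_law j u ;
  seed_law_sum1 : forall j, \sum_(u : seed) seed_law j u = 1 ;
  pull : 'I_k -> seed -> observations R n -> 'I_n ;
  message : 'I_k -> seed -> observations R n -> m.-tuple R ;
  commit : 'I_k -> seed -> observations R n -> ('I_k -> m.-tuple R) -> 'I_n }.

(* [reward i s] is the reward of the pull of arm i that comes after s previous
   pulls of arm i by the same player. *)
Fixpoint play (R : realType) (n : nat) (next : observations R n -> 'I_n)
    (reward : 'I_n -> nat -> R) (T : nat) : observations R n :=
  if T is t.+1 then
    let h := play next reward t in
    let i := next h in
    rcons h (i, reward i (count (fun e => e.1 == i) h))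
  else [::].

Section Run.
Variables (R : realType) (k n m : nat) (alg : algorithm R k n m) (T : nat).

Definition observed (u : 'I_k -> seed alg) (reward : 'I_k -> 'I_n -> nat -> R)
    (j : 'I_k) : observations R n :=
  play (pull j (u j)) (reward j) T.

Definition decision (u : 'I_k -> seed alg) (reward : 'I_k -> 'I_n -> nat -> R)
    (j : 'I_k) : 'I_n :=
  commit j (u j) (observed u reward j)
    (fun j' => message j' (u j') (observed u reward j')).

Definition identifies (u : 'I_k -> seed alg) (b : 'I_n)
    (reward : 'I_k -> 'I_n -> nat -> R) : Prop :=
  forall j, decision u reward j = b.

End Run.

(* The random variables X i, i : I, are mutually independent. *)
Definition mutually_independent (R : realType) (d : measure_display)
    (Omega : measurableType d) (P : probability Omega R) (I : eqType)
    (X : I -> {RV P >-> R}) : Prop :=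
  forall (s : seq I) (A : I -> set R), uniq s -> (forall i, measurable (A i)) ->
    P (\bigcap_(i in [set` s]) (X i @^-1` A i)) =
    (\prod_(i <- s) P (X i @^-1` A i))%E.

(* X j i s is the reward of the s-th pull (from 0) of arm i by player j. *)
Record bandit (R : realType) (d : measure_display) (Omega : measurableType d)
    (P : probability Omega R) (k n : nat) (p : 'I_n -> R)
    (X : 'I_k -> 'I_n -> nat -> {RV P >-> R}) : Prop := Bandit {
  reward_in01 : forall j i s w, 0 <= X j i s w <= 1 ;
  reward_same_law : forall i j j' s s' (A : set R), measurable A ->
    distribution P (X j i s) A = distribution P (X j' i s') A ;
  reward_mean : forall j i s, ('E_P[X j i s] = (p i)%:E)%E ;
  reward_independent :
    mutually_independent (fun q : 'I_k * 'I_n * nat => X q.1.1 q.1.2 q.2) }.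

Definition unique_best (R : realType) (n : nat) (p : 'I_n -> R) (b : 'I_n) :
    Prop :=
  forall i, i != b -> p i < p b.

Definition success_event (R : realType) (k n m : nat) (alg : algorithm R k n m)
    (T : nat) (d : measure_display) (Omega : measurableType d)
    (P : probability Omega R) (X : 'I_k -> 'I_n -> nat -> {RV P >-> R})
    (b : 'I_n) (u : {ffun 'I_k -> seed alg}) : set Omega :=
  [set w | identifies T u b (fun j i s => X j i s w)].

(* Probability of success over both the seeds and the rewards. *)
Definition success_probability (R : realType) (k n m : nat)
    (alg : algorithm R k n m) (T : nat) (d : measure_display)
    (Omega : measurableType d) (P : probability Omega R)
    (X : 'I_k -> 'I_n -> nat -> {RV P >-> R}) (b : 'I_n) : \bar R :=
  (\sum_(u : {ffun 'I_k -> seed alg})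
     (\prod_(j < k) seed_law j (u j))%:E * P (success_event T X b u))%E.

(* The quantity log (1/delta) inside a big-O.  It equals ln (1/delta) for
   delta <= 1/e.  For larger delta, ln (1/delta) tends to 0 and is then
   negative, so that "O(log (1/delta)) values" with an absolute constant
   would forbid all communication. *)
Definition log_inv (R : realType) (delta : R) : R := Num.max 1 (ln delta^-1).

(* With b the best arm, p b - p i is the gap Delta_i; the arms are not sorted,
   so the index range 2, ..., n becomes i != b. *)
Definition pull_bound (R : realType) (k n : nat) (delta : R) (p : 'I_n -> R)
    (b : 'I_n) : R :=
  (Num.sqrt (k%:R : R))^-1 *
  \sum_(i < n | i != b)
     ((p b - p i) ^+ 2)^-1 * ln (n%:R / (p b - p i)) * log_inv delta.

(* Main.v *)
Require Import Defs.
From mathcomp Require Import ring lra zify measurable_realfun.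

(* Each player draws a random set of arms, every arm with probability q, runs
   UCB on it for T/3 pulls, votes for the arm it pulled most, and spends the
   rest of its budget on that arm; it broadcasts its vote and a mean reward.
   Among the arms with more than theta votes the one with the best mean, over
   all its voters, is elected.  The mean only uses the rewards whose index in
   the stream of the arm lies in [T/3, T - T/3): these have been observed by
   the end, whatever UCB did, and they are independent of all the votes.

   Let L = log (1/delta).  If sqrt k >= 16 L, then q = 16/sqrt k and
   theta = sqrt k: by Markov's inequality a player votes for the best arm with
   probability at least 2/sqrt k, so by Chernoff's bound the best arm gets more
   than sqrt k votes except with probability exp(-16 L); an arm with that many
   votes has a mean over sqrt k * T/3 samples, which is precise enough.  No
   repetition is needed, so two numbers per player suffice.  If sqrt k <= 16 L,
   then q = 1 and theta = k/2: the budget allows each player to find the best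
   arm among all arms with failure probability 2 exp(-128 L/sqrt k), and a
   majority of the k players fails with probability exp(-Omega(sqrt k L)). *)

Set Implicit Arguments.
Unset Strict Implicit.
Unset Printing Implicit Defensive.

Local Open Scope classical_set_scope.
Local Open Scope ring_scope.

(** * Independence of events determined by disjoint sets of variables *)

Section Independence.
Context (d : measure_display) (Omega : measurableType d) (R : realType).
Variable P : probability Omega R.

(** Two finite measures, the restriction of [P] to [F] and [P] scaled by [P F], agree on the
    pi-system [G], which contains the whole space; by uniqueness of measures they agree on the
    sigma-algebra it generates. *)
Lemma independence_sigma (G : set (set Omega)) (F : set Omega) :
  G `<=` measurable -> setI_closed G -> G setT -> measurable F ->
  (forall E, G E -> P (E `&` F) = (P E * P F)%E) ->
  forall E, <<s G >> E -> P (E `&` F) = (P E * P F)%E.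
Proof.
move=> Gm GI GT mF indG E sE.
have PF : (fine (P F))%:E = P F by rewrite fineK ?fin_num_measure.
pose c := NngNum (fine_ge0 (measure_ge0 P F)).
pose m1 : {measure set Omega -> \bar R} := mrestr P mF.
pose m2 : {measure set Omega -> \bar R} := mscale c P.
have : m1 E = m2 E; last by rewrite /m1 /m2 /= /mrestr /mscale /= PF muleC.
apply: (g_sigma_algebra_measure_unique G Gm (fun=> setT)) => //.
- exact: bigcup_const.
- by move=> A GA; rewrite /m1 /m2 /= /mrestr /mscale /= indG// PF muleC.
- move=> _; rewrite /m1 /= /mrestr setTI.
  by rewrite (le_lt_trans (probability_le1 P mF))// ltry.
Qed.

Variables (I : eqType) (X : I -> {RV P >-> R}).

(** The pi-system that generates the sigma-algebra of the variables [X i] with [i] in [D]. *)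
Definition cylinders (D : pred I) : set (set Omega) :=
  [set E | exists (s : seq I) (A : I -> set R),
    [/\ uniq s, {subset s <= D}, forall i, measurable (A i) &
        E = \bigcap_(i in [set` s]) (X i @^-1` A i)]].

(** Dependence is membership in a sigma-algebra, so measurability lemmas for that sigma-algebra
    serve as proofs of dependence. *)
Definition depends_on (D : pred I) (E : set Omega) : Prop := <<s cylinders D >> E.

Lemma cylinders_setI D : setI_closed (cylinders D).
Proof.
move=> _ _ [s [A [us sD mA ->]]] [s' [A' [us' sD' mA' ->]]].
pose B i := (if i \in s then A i else setT) `&` (if i \in s' then A' i else setT).
exists (undup (s ++ s')), B; split.
- exact: undup_uniq.
- by move=> i; rewrite mem_undup mem_cat => /orP[/sD|/sD'].
- by move=> i; apply: measurableI; case: ifP.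
- apply/seteqP; split => w /=.
    move=> [h h'] i _; split => /=; first by case: ifP => // /h.
    by case: ifP => // /h'.
  move=> h; split => i /= si.
    have [/=] : (X i @^-1` B i) w.
      by apply: h; rewrite /= mem_undup mem_cat si.
    by rewrite si.
  have [/=] : (X i @^-1` B i) w.
    by apply: h; rewrite /= mem_undup mem_cat si orbT.
  by rewrite si.
Qed.

Lemma cylinders_setT D : cylinders D setT.
Proof.
exists [::], (fun=> setT); split => //.
by apply/seteqP; split => // w _ i.
Qed.

Lemma cylinders_measurable D : cylinders D `<=` measurable.
Proof.
move=> _ [s [A [_ _ mA ->]]].
apply: fin_bigcap_measurable => [|i _]; first exact: finite_seq.
rewrite -[_ @^-1` _]setTI; exact: measurable_funPT.
Qed.

Lemma depends_on_measurable D E : depends_on D E -> measurable E.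
Proof.
apply: smallest_sub; first exact: sigma_algebra_measurable.
exact: cylinders_measurable.
Qed.

Lemma depends_on_subset (D D' : pred I) E :
  {subset D <= D'} -> depends_on D E -> depends_on D' E.
Proof.
move=> sDD'; apply: smallest_sub; first exact: smallest_sigma_algebra.
move=> F [s [A [us sD mA FE]]]; apply: sub_sigma_algebra.
by exists s, A; split => // i /sD/sDD'.
Qed.

Lemma depends_on_preimage (D : pred I) i (A : set R) :
  D i -> measurable A -> depends_on D (X i @^-1` A).
Proof.
move=> Di mA; apply: sub_sigma_algebra; exists [:: i], (fun=> A); split => //.
  by move=> j; rewrite inE => /eqP->.
apply/seteqP; split => w /= => [h j|]; first by rewrite /= inE => /eqP->.
by apply; rewrite /= inE.
Qed.

Hypothesis indX : mutually_independent X.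

(** [independence_sigma] is used twice, to reduce first [E] and then [F] to a cylinder. For two
    cylinders, disjointness of [D] and [D'] makes the concatenated index list duplicate-free, and
    mutual independence splits the product. *)
Lemma disjoint_independence (D D' : pred I) E F :
  (forall i, D i -> ~~ D' i) -> depends_on D E -> depends_on D' F ->
  P (E `&` F) = (P E * P F)%E.
Proof.
move=> disj dE dF; apply: independence_sigma dE => //.
- exact: cylinders_measurable.
- exact: cylinders_setI.
- exact: cylinders_setT.
- exact: depends_on_measurable dF.
move=> {}E cE; rewrite setIC muleC; apply: independence_sigma dF => //.
- exact: cylinders_measurable.
- exact: cylinders_setI.
- exact: cylinders_setT.
- exact: (cylinders_measurable cE).
move=> {}F [s' [A' [us' sD' mA' ->]]].
have [s [A [us sD mA ->]]] := cE.
pose B i := if D i then A i else A' i.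
have sB i : i \in s -> B i = A i by move=> /sD; rewrite /B unfold_in => ->.
have sB' i : i \in s' -> B i = A' i.
  move=> /sD'; rewrite /B unfold_in => D'i.
  by rewrite ifF//; apply/negP => /disj; rewrite D'i.
have mB i : measurable (B i) by rewrite /B; case: ifP.
have uss' : uniq (s ++ s').
  rewrite cat_uniq us us' andbT /=; apply/hasPn => i /sD'; rewrite unfold_in => D'i.
  by apply/negP => /sD; rewrite unfold_in => /disj; rewrite D'i.
rewrite setIC (_ : _ `&` _ = \bigcap_(i in [set` s ++ s']) (X i @^-1` B i)); last first.
  apply/seteqP; split => w /=.
    move=> [h h'] i; rewrite /= mem_cat => /orP[] si.
      by rewrite /= sB//; exact: h.
    by rewrite /= sB'//; exact: h'.
  move=> h; split => i /= si.
    by rewrite -sB//; apply: (h i); rewrite /= mem_cat si.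
  by rewrite -sB'//; apply: (h i); rewrite /= mem_cat si orbT.
rewrite indX// big_cat /= indX// indX// muleC.
congr (_ * _)%E; apply: eq_big_seq => i si; first by rewrite sB'.
by rewrite sB.
Qed.

(** By induction: the intersection over the tail depends on the union of the tail's index sets,
    which is disjoint from [D j]. *)
Lemma disjoint_independence_seq (J : eqType) (D : J -> pred I)
    (E : J -> set Omega) (s : seq J) :
  (forall j j' i, D j i -> D j' i -> j = j') ->
  (forall j, depends_on (D j) (E j)) -> uniq s ->
  P (\bigcap_(j in [set` s]) E j) = (\prod_(j <- s) P (E j))%E.
Proof.
move=> disj dE; elim: s => [_|j s IH /= /andP[js us]].
  by rewrite big_nil set_nil bigcap_set0 probability_setT.
have cons_seq : [set` j :: s] = j |` [set` s].
  by apply/seteqP; split => i /=; rewrite inE => /predU1P.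
pose Ds : pred I := fun i => has (fun j' => D j' i) s.
have dEs : depends_on Ds (\bigcap_(j' in [set` s]) E j').
  apply: (@fin_bigcap_measurable _ (g_sigma_algebraType (cylinders Ds))).
    exact: finite_seq.
  move=> j' /= sj'; apply: depends_on_subset (dE j') => i Di.
  by apply/hasP; exists j'.
rewrite big_cons -IH// cons_seq bigcap_setU1.
apply: disjoint_independence (dE j) dEs => i Di.
apply/hasPn => j' sj'; apply/negP => /(disj _ _ _ Di) jj'.
by move: js; rewrite jj' sj'.
Qed.

End Independence.

(** * Deviation of sums of independent variables *)

Section Measurability.
Context (d : measure_display) (Omega : measurableType d) (R : realType).
Variables (I : eqType) (f : I -> Omega -> R) (s : seq I).
Hypothesis mf : forall i, i \in s -> measurable_fun setT (f i).

Lemma measurable_fun_sum_in : measurable_fun setT (fun w => \sum_(i <- s) f i w).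
Proof.
have -> : (fun w => \sum_(i <- s) f i w) =
          (fun w => \sum_(i <- s) (if i \in s then f i else cst 0) w).
  by apply/funext => w; apply: eq_big_seq => i ->.
by apply: measurable_sum => i; case: ifP => // /mf.
Qed.

End Measurability.

(** * Expectation of a product of independent variables *)

Section IndependentExpectation.
Context (d : measure_display) (Omega : measurableType d) (R : realType).
Variable P : probability Omega R.

(** The hypothesis on rectangles identifies the law of the pair with the product of the two laws;
    Tonelli's theorem then splits the integral. *)
Lemma ge0_expectationM_independent (Y Z : Omega -> R) :
  measurable_fun setT Y -> measurable_fun setT Z ->
  (forall w, 0 <= Y w) -> (forall w, 0 <= Z w) ->
  (forall A B, measurable A -> measurable B ->
    P (Y @^-1` A `&` Z @^-1` B) = (P (Y @^-1` A) * P (Z @^-1` B))%E) ->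
  ('E_P[Y \* Z] = 'E_P[Y] * 'E_P[Z])%E.
Proof.
move=> mY mZ Y0 Z0 indYZ.
pose Y' : {RV P >-> R} := mfun_Sub (mem_set mY).
pose Z' : {RV P >-> R} := mfun_Sub (mem_set mZ).
pose YZ w := (Y w, Z w).
have mYZ : measurable_fun setT YZ by apply: measurable_fun_pair.
pose YZ' : {RV P >-> (R * R)%type} := mfun_Sub (mem_set mYZ).
(* The absolute value does not affect the values of [Y] and [Z], and makes the integrand nonnegative
   on the whole line, as Tonelli's theorem requires. *)
pose g (y : R) : \bar R := (`|y|)%:E.
have mg : measurable_fun [set: R] g.
  by apply/measurable_EFinP; exact: normr_measurable.
have g0 y : (0 <= g y)%E by rewrite lee_fin.
pose f (z : R * R) : \bar R := (g z.1 * g z.2)%E.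
have mf : measurable_fun [set: (R * R)%type] f.
  apply: emeasurable_funM.
    by apply: (measurableT_comp mg); exact: measurable_fst.
  by apply: (measurableT_comp mg); exact: measurable_snd.
have f0 z : (0 <= f z)%E by apply: mule_ge0.
have gY : (\int[distribution P Y']_y g y = 'E_P[Y])%E.
  rewrite ge0_integral_distribution// unlock; apply: eq_integral => w _ /=.
  by rewrite /g ger0_norm// Y0.
have gZ : (\int[distribution P Z']_y g y = 'E_P[Z])%E.
  rewrite ge0_integral_distribution// unlock; apply: eq_integral => w _ /=.
  by rewrite /g ger0_norm// Z0.
transitivity (\int[distribution P YZ']_z f z)%E.
  rewrite ge0_integral_distribution// unlock; apply: eq_integral => w _ /=.
  by rewrite /f /g /= !ger0_norm// ?Y0 ?Z0// EFinM.
have prodE A : measurable A ->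
    (distribution P Y' \x distribution P Z')%E A = distribution P YZ' A.
  by apply: product_measure_unique => B C mB mC; exact: indYZ.
rewrite (eq_measure_integral (distribution P Y' \x distribution P Z')%E); last first.
  by move=> A mA _; exact/esym/prodE.
rewrite fubini_tonelli1// /fubini_F /f /=.
under eq_integral => y _ do rewrite ge0_integralZl//= gZ.
by rewrite ge0_integralZr// ?gY// expectation_ge0.
Qed.

End IndependentExpectation.

(** After squaring [expR (x / 2) <= (1 - x / 2)^-1], what remains is
    [1 <= (1 + x + x^2) (1 - x/2)^2], where the right side exceeds 1 by [x^2 (1 - 3x + x^2) / 4]. *)
Lemma expR_le_quadratic (R : realType) (x : R) :
  `|x| <= 1 / 4 -> expR x <= 1 + x + x ^+ 2.
Proof.
rewrite ler_norml => /andP[x1 x2].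
have e1 : expR (- (x / 2)) >= 1 - x / 2 by apply: expR_ge1Dx.
have -> : x = x / 2 + x / 2 by lra.
rewrite expRD.
have h : expR (x / 2) <= (1 - x / 2)^-1.
  by rewrite -[expR _]invrK -expRN lef_pV2 ?posrE ?expR_gt0//; lra.
have p : 0 < 1 - x / 2 by lra.
apply: le_trans (_ : (1 - x / 2)^-1 * (1 - x / 2)^-1 <= _).
  by apply: ler_pM => //; exact: expR_ge0.
rewrite -invfM -div1r ler_pdivrMr ?mulr_gt0//; nra.
Qed.

Section Deviation.
Context (d : measure_display) (Omega : measurableType d) (R : realType).
Variable P : probability Omega R.
Variables (I : eqType) (X : I -> {RV P >-> R}).
Hypothesis indX : mutually_independent X.

Lemma depends_on_measurable_fun (D : pred I) i : D i ->
  measurable_fun setT (X i : g_sigma_algebraType (cylinders X D) -> R).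
Proof. by move=> Di _ A mA; rewrite setTI; exact: depends_on_preimage. Qed.

Variables (mu : R) (s : seq I).
Hypotheses (X01 : forall i w, i \in s -> 0 <= X i w <= 1).
Hypotheses (EX : forall i, i \in s -> ('E_P[X i] = mu%:E)%E).

Lemma expectation01 i : i \in s -> 0 <= mu <= 1.
Proof.
move=> si; rewrite -!lee_fin -(EX si); apply/andP; split.
  by apply: expectation_ge0 => w; case/andP: (X01 w si).
rewrite -[leRHS](expectation_cst P); apply: expectation_le => //.
- by move=> w; case/andP: (X01 w si).
- by apply: aeW => w; case/andP: (X01 w si).
Qed.

(** Since [(X i - mu)^2 <= 1], the quadratic bound becomes affine in [X i]. Its expectation involves
    only the mean, the linear term cancels, and [1 + lam^2] is left. *)
Lemma expectation_expR_centered lam i : `|lam| <= 1 / 4 -> i \in s ->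
  ('E_P[fun w => expR (lam * (X i w - mu))] <= (expR (lam ^+ 2))%:E)%E.
Proof.
move=> lam4 si.
have [mu0 mu1] := andP (expectation01 si).
have int1 : (X i : Omega -> R) \in Lfun P 1.
  apply/Lfun1_integrable/measurable_bounded_integrable => //.
    by rewrite (le_lt_trans (probability_le1 P _))// ltry.
  exists 1; split => // M M1 w _ /=; have [x0 x1] := andP (X01 w si).
  by rewrite ger0_norm// (le_trans x1)// ltW.
have intl : (lam \o* X i : Omega -> R) \in Lfun P 1 by apply: Lfun_scale.
have bound w : expR (lam * (X i w - mu)) <= 1 + lam ^+ 2 - lam * mu + lam * X i w.
  have [x0 x1] := andP (X01 w si).
  have n1 : `|X i w - mu| <= 1 by rewrite ler_norml; apply/andP; split; lra.
  apply: le_trans (expR_le_quadratic _) _.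
    by rewrite normrM -[leRHS]mulr1 ler_pM.
  have : (lam * (X i w - mu)) ^+ 2 <= lam ^+ 2.
    rewrite exprMn -[leRHS]mulr1 ler_wpM2l ?sqr_ge0//.
    by move: n1; rewrite ler_norml => /andP[]; nra.
  lra.
apply: (@le_trans _ _ ('E_P[(cst (1 + lam ^+ 2 - lam * mu) \+ (lam \o* X i))%R])%E).
  apply: expectation_le.
  - apply: measurableT_comp => //; apply: measurable_funM => //.
    exact: measurable_funB.
  - by apply: measurable_funD => //; apply: measurable_funM.
  - by move=> w; exact: expR_ge0.
  - by move=> w /=; rewrite (mulrC (X i w)); apply: le_trans (bound w); exact: expR_ge0.
  - by apply: aeW => w /=; rewrite (mulrC (X i w)).
rewrite expectationD//; last exact: Lfun_cst.
rewrite expectation_cst expectationZl// EX// -EFinM -EFinD lee_fin.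
by rewrite subrK; exact: expR_ge1Dx.
Qed.


Lemma expectation_expR_sum_centered lam : `|lam| <= 1 / 4 -> uniq s ->
  ('E_P[fun w => expR (lam * \sum_(i <- s) (X i w - mu))] <=
   (expR ((size s)%:R * lam ^+ 2))%:E)%E.
Proof.
(* The induction runs over lists contained in [s], so that the hypotheses on the members of [s] stay
   available. *)
move=> lam4; have : {subset s <= s} by [].
elim: {1 3 4 5}s => [_ _|i t IH ts /= /andP[it ut]].
  under eq_fun do rewrite big_nil mulr0.
  by rewrite expectation_cst mul0r.
have mc j : measurable_fun setT (fun w => X j w - mu) by exact: measurable_funB.
have mX : measurable_fun setT (fun w => expR (lam * (X i w - mu))).
  by apply: measurableT_comp => //; apply: measurable_funM.
pose S w := expR (lam * \sum_(j <- t) (X j w - mu)).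
have mS (D : pred I) : {subset t <= D} ->
    measurable_fun setT (S : g_sigma_algebraType (cylinders X D) -> R).
  move=> tD; apply: measurableT_comp => //; apply: measurable_funM => //.
  apply: (@measurable_fun_sum_in _ (g_sigma_algebraType (cylinders X D))) => j tj.
  by apply: measurable_funB => //; apply: depends_on_measurable_fun; exact: tD.
have -> : (fun w => expR (lam * \sum_(j <- i :: t) (X j w - mu))) =
          (fun w => expR (lam * (X i w - mu))) \* S.
  by apply/funext => w /=; rewrite big_cons mulrDr expRD.
have indXS A B : measurable A -> measurable B ->
    P ((fun w => expR (lam * (X i w - mu))) @^-1` A `&` S @^-1` B) =
    (P ((fun w => expR (lam * (X i w - mu))) @^-1` A) * P (S @^-1` B))%E.
  move=> mA mB.
  have dX : depends_on X (pred1 i) ((fun w => expR (lam * (X i w - mu))) @^-1` A).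
    apply: (@depends_on_preimage _ _ _ _ _ X (pred1 i) i
             ((fun x => expR (lam * (x - mu))) @^-1` A)).
      by rewrite /= eqxx.
    rewrite -[_ @^-1` _]setTI.
    suff /(_ measurableT A mA) :
      measurable_fun [set: R] (fun x => expR (lam * (x - mu))) by [].
    apply: measurableT_comp => //; apply: measurable_funM => //.
    exact: measurable_funB.
  have dS : depends_on X (mem t) (S @^-1` B).
    by rewrite -[_ @^-1` _]setTI; apply: (mS (mem t)).
  by apply: (disjoint_independence indX _ dX dS) => j /= /eqP->.
have mST : measurable_fun setT S.
  apply: measurableT_comp => //; apply: measurable_funM => //.
  exact: measurable_sum.
rewrite (ge0_expectationM_independent mX mST (fun=> expR_ge0 _) (fun=> expR_ge0 _) indXS).
rewrite -natr1 mulrDl mul1r addrC expRD EFinM.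
apply: lee_pmul.
- by apply: expectation_ge0 => w; exact: expR_ge0.
- by apply: expectation_ge0 => w; exact: expR_ge0.
- by apply: expectation_expR_centered => //; apply: ts; rewrite inE eqxx.
- by apply: IH => // j tj; apply: ts; rewrite inE tj orbT.
Qed.

(** The sign of [lam] is free, so that one exponential Markov inequality yields both tails. *)
Lemma markov_expR_sum_centered lam c : `|lam| <= 1 / 4 -> uniq s ->
  (P [set w | c <= lam * \sum_(i <- s) (X i w - mu)]%R <=
   (expR ((size s)%:R * lam ^+ 2 - c))%:E)%E.
Proof.
move=> lam4 us.
pose Z w := lam * \sum_(i <- s) (X i w - mu).
have mZ : measurable_fun setT Z.
  apply: measurable_funM => //; apply: measurable_sum => i.
  exact: measurable_funB.
pose Z' : {RV P >-> R} := mfun_Sub (mem_set mZ).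
have := chernoff Z' c ltr01; rewrite mul1r => /le_trans; apply.
rewrite expRD EFinM lee_wpmul2r ?lee_fin ?expR_ge0//.
rewrite /mmt_gen_fun (_ : _ \o _ = fun w => expR (Z w)).
  exact: expectation_expR_sum_centered.
by apply/funext => w /=; rewrite mulr1.
Qed.

Hypothesis us : uniq s.

Lemma sum_centered w :
  \sum_(i <- s) (X i w - mu) = \sum_(i <- s) X i w - (size s)%:R * mu.
Proof. by rewrite sumrB big_const_seq count_predT iter_addr_0 mulr_natl. Qed.

Lemma sum01 w : 0 <= \sum_(i <- s) X i w <= (size s)%:R.
Proof.
apply/andP; split.
  by rewrite big_seq; apply: sumr_ge0 => i /(X01 w)/andP[].
have -> : (size s)%:R = \sum_(i <- s | i \in s) 1 :> R.
  by rewrite -big_seq -sum1_size natr_sum.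
rewrite big_seq.
by apply: ler_sum => i /(X01 w)/andP[].
Qed.

Let measurable_sumX : measurable_fun setT (fun w => \sum_(i <- s) X i w).
Proof. exact: measurable_sum. Qed.

Lemma measurable_sum_ge c : measurable [set w | c <= \sum_(i <- s) X i w].
Proof. by rewrite -[X in measurable X]setTI; apply: measurable_fun_le. Qed.

Lemma measurable_sum_le c : measurable [set w | \sum_(i <- s) X i w <= c].
Proof. by rewrite -[X in measurable X]setTI; apply: measurable_fun_le. Qed.

Let measurable_linear a c :
  measurable [set w | c <= a * \sum_(i <- s) (X i w - mu)].
Proof.
rewrite -[X in measurable X]setTI; apply: measurable_fun_le => //.
apply: measurable_funM => //; apply: measurable_sum => i.
exact: measurable_funB.
Qed.

Lemma deviation_upper eps : 0 <= eps ->
  (P [set w | (size s)%:R * (mu + eps) <= \sum_(i <- s) X i w]%R <=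
   (expR (- ((size s)%:R * eps ^+ 2 / 8)))%:E)%E.
Proof.
move=> eps0; have [s0|s_gt0] := posnP (size s).
  by rewrite s0 !mul0r oppr0 expR0; apply/probability_le1/measurable_sum_ge.
have S0 : 0 < (size s)%:R :> R by rewrite ltr0n.
have [i si] : exists i, i \in s.
  by case: (s) s_gt0 => // i t _; exists i; rewrite inE eqxx.
have [mu0 mu1] := andP (expectation01 si).
(* For [eps > 1] the event is empty because the variables lie in [0, 1]. Otherwise [lam = eps / 4]
   is admissible and gives the exponent [-3/16] times [size s * eps^2], below the claimed [-1/8]. *)
have [eps1|eps1] := leP eps 1; last first.
  rewrite (_ : [set w | _] = set0) ?measure0 ?lee_fin ?expR_ge0//.
  apply/seteqP; split => // w /=; have [_ h] := andP (sum01 w).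
  by move=> /le_trans/(_ h); nra.
have lam4 : `|eps / 4| <= 1 / 4 by rewrite ger0_norm ?divr_ge0// ler_pM2r.
apply: le_trans (_ : (_ <= P [set w | (size s)%:R * eps ^+ 2 / 4 <=
    eps / 4 * \sum_(i <- s) (X i w - mu)]%R)%E) _.
  apply: le_measure; rewrite ?inE//; first exact: measurable_sum_ge.
  by move=> w /=; rewrite sum_centered; nra.
apply: le_trans (markov_expR_sum_centered _ lam4 us) _.
by rewrite lee_fin ler_expR; nra.
Qed.

Lemma deviation_lower eps : 0 <= eps ->
  (P [set w | \sum_(i <- s) X i w <= (size s)%:R * (mu - eps)]%R <=
   (expR (- ((size s)%:R * eps ^+ 2 / 8)))%:E)%E.
Proof.
move=> eps0; have [s0|s_gt0] := posnP (size s).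
  by rewrite s0 !mul0r oppr0 expR0; apply/probability_le1/measurable_sum_le.
have S0 : 0 < (size s)%:R :> R by rewrite ltr0n.
have [i si] : exists i, i \in s.
  by case: (s) s_gt0 => // i t _; exists i; rewrite inE eqxx.
have [mu0 mu1] := andP (expectation01 si).
have [eps1|eps1] := leP eps 1; last first.
  rewrite (_ : [set w | _] = set0) ?measure0 ?lee_fin ?expR_ge0//.
  apply/seteqP; split => // w /=; have [h _] := andP (sum01 w).
  by move=> /(le_trans h); nra.
have lam4 : `|- (eps / 4)| <= 1 / 4.
  by rewrite normrN ger0_norm ?divr_ge0// ler_pM2r.
apply: le_trans (_ : (_ <= P [set w | (size s)%:R * eps ^+ 2 / 4 <=
    - (eps / 4) * \sum_(i <- s) (X i w - mu)]%R)%E) _.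
  apply: le_measure; rewrite ?inE//; first exact: measurable_sum_le.
  by move=> w /=; rewrite sum_centered; nra.
apply: le_trans (markov_expR_sum_centered _ lam4 us) _.
by rewrite lee_fin ler_expR; nra.
Qed.

End Deviation.

(** * Histories and the UCB rule *)

Section ArgMax.
Variables (R : realDomainType) (n : nat).
Implicit Type f : 'I_n.+1 -> R.

(** The result depends on [f] only through the comparisons [f l <= f i]; this makes the argmax of
    random scores measurable. The default is never reached. *)
Definition argmax f : 'I_n.+1 := odflt ord0 [pick i | [forall l, f l <= f i]].

Lemma argmaxP f i : f i <= f (argmax f).
Proof.
rewrite /argmax; case: pickP => [l /forallP//|no].
have [m _ maxm] := arg_maxP f (isT : xpredT (ord0 : 'I_n.+1)).
by move/negP: (no m); case; apply/forallP => l; apply: maxm.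
Qed.

Lemma argmax_unique f b : (forall i, i != b -> f i < f b) -> argmax f = b.
Proof.
by move=> fb; apply/eqP; apply/negPn/negP => /fb; rewrite ltNge argmaxP.
Qed.

End ArgMax.

Section Play.
Variables (R : realType) (n : nat).
Implicit Types (next : observations R n -> 'I_n) (reward : 'I_n -> nat -> R).
Implicit Types (h : observations R n) (i : 'I_n).

Definition rewards_of i h : seq R := [seq e.2 | e <- h & e.1 == i].

Lemma size_rewards_of i h : size (rewards_of i h) = count (fun e => e.1 == i) h.
Proof. by rewrite size_map size_filter. Qed.

Lemma size_play next reward T : size (play next reward T) = T.
Proof. by elim: T => //= t IH; rewrite size_rcons IH. Qed.

Lemma take_play next reward t T : (t <= T)%N ->
  take t (play next reward T) = play next reward t.
Proof.
elim: T => [|T IH]; first by rewrite leqn0 => /eqP->.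
rewrite leq_eqVlt => /predU1P[->|]; first by rewrite take_oversize ?size_play.
by rewrite ltnS => tT; rewrite /= -cats1 takel_cat ?size_play// IH.
Qed.

Lemma eq_play_next next next' reward T :
  (forall h, (size h < T)%N -> next h = next' h) ->
  play next reward T = play next' reward T.
Proof.
elim: T => //= T IH H; rewrite IH => [|h hT]; last by apply: H; exact: ltnW.
by rewrite H// size_play.
Qed.

Lemma count_play_le next reward i T :
  (size (rewards_of i (play next reward T)) <= T)%N.
Proof. by rewrite size_rewards_of -[leqRHS](size_play next reward T) count_size. Qed.

(** The index read at a step is the number of earlier pulls of the arm, hence at most the number of
    earlier steps. *)
Lemma eq_play_reward next reward reward' T :
  (forall i s, (s < T)%N -> reward i s = reward' i s) ->
  play next reward T = play next reward' T.
Proof.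
elim: T => //= T IH H; rewrite IH => [|i s sT]; last by apply: H; exact: ltnW.
rewrite H// ltnS -size_rewards_of; exact: count_play_le.
Qed.

Lemma rewards_of_rcons i h e :
  rewards_of i (rcons h e) =
  if e.1 == i then rcons (rewards_of i h) e.2 else rewards_of i h.
Proof. by rewrite /rewards_of filter_rcons; case: ifP; rewrite ?map_rcons. Qed.

Lemma rewards_of_play next reward i T :
  rewards_of i (play next reward T) =
  mkseq (reward i) (size (rewards_of i (play next reward T))).
Proof.
elim: T => //= T IH; rewrite rewards_of_rcons /=; case: eqP => [->|//].
by rewrite size_rcons mkseqS {1}IH size_rewards_of.
Qed.

Lemma count_playS next reward i T :
  size (rewards_of i (play next reward T.+1)) =
  (size (rewards_of i (play next reward T)) +
   (next (play next reward T) == i))%N.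
Proof.
by rewrite /= rewards_of_rcons /=; case: eqP; rewrite ?size_rcons ?addn1 ?addn0.
Qed.

Lemma sum_count_play next reward T :
  (\sum_i size (rewards_of i (play next reward T)) = T)%N.
Proof.
elim: T => [|T IH]; first by rewrite big1.
under eq_bigr do rewrite count_playS.
rewrite big_split /= IH (bigD1 (next (play next reward T)))//= eqxx big1 ?addn1//.
by move=> i /negbTE; rewrite eq_sym => ->.
Qed.

Lemma sum_rewards_of_play next reward i T :
  \sum_(x <- rewards_of i (play next reward T)) x =
  \sum_(s < size (rewards_of i (play next reward T))) reward i s.
Proof.
by rewrite -(big_mkord xpredT (reward i)) {1}rewards_of_play big_map /index_iota subn0.
Qed.

End Play.

Section Ucb.
Variables (R : realType) (n : nat) (radius : nat -> R).
Implicit Types (u : {ffun 'I_n.+1 -> bool}) (h : observations R n.+1).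

(* An arm that has not been pulled has index [0 / 0 + radius 0 = 1], which is at
   least its mean; the arms outside [u] get an index below all the others. *)
Definition ucb_index u (N : 'I_n.+1 -> nat) (S : 'I_n.+1 -> R) i : R :=
  if u i then S i / (N i)%:R + radius (N i) else -1.

Definition ucb_pull u h : 'I_n.+1 :=
  argmax (ucb_index u (fun i => size (rewards_of i h))
                      (fun i => \sum_(x <- rewards_of i h) x)).

(** The successor ranks even an unpulled arm of [u] above every arm outside [u]. *)
Definition most_pulled u (N : 'I_n.+1 -> nat) : 'I_n.+1 :=
  argmax (fun i => if u i then (N i).+1%:R else 0 : R).

Definition vote u h : 'I_n.+1 := most_pulled u (fun i => size (rewards_of i h)).

Lemma ucb_pull_play next u (reward : 'I_n.+1 -> nat -> R) t :
  let h := play next reward t in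
  let N i := size (rewards_of i h) in
  ucb_pull u h = argmax (ucb_index u N (fun i => \sum_(s < N i) reward i s)).
Proof.
congr argmax; apply/funext => i; rewrite /ucb_index.
by rewrite sum_rewards_of_play.
Qed.

Variables (u : {ffun 'I_n.+1 -> bool}) (reward : 'I_n.+1 -> nat -> R) (T : nat).
Variables (p tau : 'I_n.+1 -> R) (b : 'I_n.+1).
Hypotheses (radius_ge0 : forall t, 0 <= radius t) (radius0 : radius 0 = 1).
Hypothesis reward_ge0 : forall i s, 0 <= reward i s.
Hypothesis p_le1 : p b <= 1.
Hypothesis confidence : forall i t, (0 < t <= T)%N ->
  `|(\sum_(s < t) reward i s) / t%:R - p i| <= radius t.
Hypothesis tau_ge1 : forall i, i != b -> 1 <= tau i.
Hypothesis radius_tau : forall i t, i != b -> (0 < t)%N ->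
  p b - p i <= radius t *+ 2 -> t.+1%:R <= tau i.
Hypothesis ub : u b.

Let h t := play (ucb_pull u) reward t.
Let N t i := size (rewards_of i (h t)).
Let S t i := \sum_(s < N t i) reward i s.

Let ucb_pullE t : ucb_pull u (h t) = argmax (ucb_index u (N t) (S t)).
Proof. exact: ucb_pull_play. Qed.

Let S_ge0 t i : 0 <= S t i. Proof. exact: sumr_ge0. Qed.

Let index_pulled t i : ucb_pull u (h t) = i -> u i.
Proof.
rewrite ucb_pullE => ti; have := argmaxP (ucb_index u (N t) (S t)) b.
rewrite ti /ucb_index ub; case: ifP => // _.
have : 0 <= S t b / (N t b)%:R by rewrite divr_ge0.
have := radius_ge0 (N t b); lra.
Qed.

(** The usual UCB argument: when [i] is pulled its index is at least that of [b], hence at least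
    [p b], while it is at most [p i] plus twice the radius. So [radius_tau] bounds the count after
    this pull, whence the successor there; a first pull is covered by [tau_ge1]. *)
Let N_le t i : (t <= T)%N -> i != b -> (N t i)%:R <= tau i.
Proof.
move=> + ib; elim: t => [|t IH] tT; first by rewrite (le_trans _ (tau_ge1 ib)).
rewrite /N /h count_playS -/(h t); have [ti|_] := eqVneq; last first.
  by rewrite addn0 IH// ltnW.
rewrite addn1 -/(N t i).
have [->|Ni] := posnP (N t i); first exact: tau_ge1.
apply: radius_tau => //.
have := argmaxP (ucb_index u (N t) (S t)) b.
rewrite -ucb_pullE ti /ucb_index ub (index_pulled ti).
have /(confidence i) : (0 < N t i <= T)%N.
  by rewrite Ni (leq_trans (count_play_le _ _ _ _) (ltnW tT)).
rewrite -/(S t i) ler_norml => /andP[_ i2].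
have : p b <= S t b / (N t b)%:R + radius (N t b).
  (* If [b] is still unpulled, its index is [radius 0 = 1], which is at least [p b]. *)
  have [Nb|Nb] := posnP (N t b).
    by rewrite Nb radius0 ler_wpDl// divr_ge0.
  have /(confidence b) : (0 < N t b <= T)%N.
    by rewrite Nb (leq_trans (count_play_le _ _ _ _) (ltnW tT)).
  by rewrite -/(S t b) ler_norml => /andP[b1 _]; lra.
rewrite mulr2n; lra.
Qed.

Let N_out t i : ~~ u i -> N t i = 0%N.
Proof.
move=> ui; elim: t => // t IH.
rewrite /N /h count_playS -/(h t) -/(N t i) IH; case: eqP => // /index_pulled.
by rewrite (negbTE ui).
Qed.

(** The suboptimal arms of [u] use less than half of the [T] pulls in total, so [b] gets more pulls
    than any of them. The budget condition is vacuous when [u] contains only [b], and then [b] wins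
    without it. *)
Lemma vote_best :
  (forall i, i != b -> u i -> \sum_(l | (l != b) && u l) tau l *+ 2 < T%:R) ->
  vote u (h T) = b.
Proof.
move=> tauT; apply: argmax_unique => i ib; rewrite ub.
case: ifP => ui; last by rewrite ltr0Sn.
rewrite ltr_nat ltnS -/(N T i) -/(N T b) -(ltr_nat R).
have NT : T%:R = (N T b)%:R + \sum_(l | (l != b) && u l) (N T l)%:R :> R.
  rewrite -{1}(sum_count_play (ucb_pull u) reward T) natr_sum (bigD1 b)//=.
  congr (_ + _); rewrite [RHS]big_mkcondr; apply: eq_bigr => l _.
  by case: ifPn => // /(N_out T) Nl; rewrite -/(h T) -/(N T l) Nl.
have le1 : \sum_(l | (l != b) && u l) (N T l)%:R <= \sum_(l | (l != b) && u l) tau l.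
  by apply: ler_sum => l /andP[lb _]; exact: N_le.
have le2 : (N T i)%:R <= \sum_(l | (l != b) && u l) tau l.
  rewrite (bigD1 i) ?ib//= (le_trans (N_le (leqnn T) ib))// lerDl.
  by apply: sumr_ge0 => l /andP[/andP[lb _] _]; rewrite (le_trans ler01)// tau_ge1.
have := tauT i ib ui; rewrite sumrMnl mulr2n; lra.
Qed.

End Ucb.

(** * The algorithm *)

Section Bernoulli.
Variables (R : realType) (n : nat) (q : R).

Definition bernoulli_weight (x : bool) : R := if x then q else 1 - q.

Definition subset_law (u : {ffun 'I_n -> bool}) : R :=
  \prod_i bernoulli_weight (u i).

Hypothesis q01 : 0 <= q <= 1.

Lemma subset_law_ge0 u : 0 <= subset_law u.
Proof.
have [q0 q1] := andP q01.
by apply: prodr_ge0 => i _; rewrite /bernoulli_weight; case: ifP => _; lra.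
Qed.

(** Weight and indicator are both products over the arms, so the sum factorizes: an arm of [D]
    contributes [q], any other arm [q + (1 - q)]. *)
Lemma subset_law_contains (D : {set 'I_n}) :
  \sum_u subset_law u * (D \subset [set i | u i]%SET)%:R = q ^+ #|D|.
Proof.
pose F i (x : bool) : R := bernoulli_weight x * ((i \in D) ==> x)%:R.
have -> : \sum_u subset_law u * (D \subset [set i | u i]%SET)%:R =
          \sum_(u : {ffun 'I_n -> bool}) \prod_i F i (u i).
  apply: eq_bigr => u _; rewrite /subset_law /F big_split /=; congr (_ * _).
  have [/fintype.subsetP Du|] := boolP (D \subset _).
    by rewrite big1// => i _; case: (boolP (i \in D)) => //= /Du; rewrite inE => ->.
  case/fintype.subsetPn => i iD; rewrite inE => /negbTE ui.
  by rewrite (bigD1 i)//= iD ui mul0r.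
rewrite -(bigA_distr_bigA F) /= (bigID (mem D)) /=.
rewrite [X in _ * X]big1 ?mulr1 => [|i /negbTE iD]; last first.
  by rewrite big_bool /F iD /= !mulr1 /bernoulli_weight addrC subrK.
rewrite (eq_bigr (fun=> q)) ?prodr_const// => i iD.
by rewrite big_bool /F iD /= mulr1 mulr0 addr0.
Qed.

Lemma subset_law_sum1 : \sum_u subset_law u = 1.
Proof.
rewrite -[RHS](expr0 q) -(cards0 'I_n) -subset_law_contains.
by apply: eq_bigr => u _; rewrite finset.sub0set mulr1.
Qed.

End Bernoulli.

Section Algorithm.
Variables (R : realType) (k n : nat) (radius : nat -> R) (q theta : R) (T : nat).
Hypothesis q01 : 0 <= q <= 1.

Definition explore : nat := (T %/ 3)%N.
Definition exploit : nat := (T - explore - explore)%N.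

Implicit Types (u : {ffun 'I_n.+1 -> bool}) (h : observations R n.+1).

(** A player has no memory beyond its seed and its history, so the phase is read off the length of
    [h] and the vote is recomputed from its first [explore] entries. *)
Definition two_phase_pull u h : 'I_n.+1 :=
  if (size h < explore)%N then ucb_pull radius u h else vote u (take explore h).

Definition two_phase_message u h : 2.-tuple R :=
  let v := vote u (take explore h) in
  [tuple v%:R;
    (\sum_(explore <= s < T - explore) (rewards_of v h)`_s) / exploit%:R].

(* Means are nonnegative, so [-1] discards the arms with too few votes. *)
Definition elect (voters : 'I_n.+1 -> {set 'I_k}) (mean : 'I_k -> R) : 'I_n.+1 :=
  argmax (fun i => if theta < #|voters i|%:R
                   then (\sum_(j in voters i) mean j) / #|voters i|%:R else -1).

Definition two_phase_commit (msg : 'I_k -> 2.-tuple R) : 'I_n.+1 :=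
  elect (fun i => [set j | tnth (msg j) ord0 == i%:R]%SET)
        (fun j => tnth (msg j) ord_max).

Definition two_phase : algorithm R k n.+1 2 :=
  @Algorithm R k n.+1 2 {ffun 'I_n.+1 -> bool} (fun=> subset_law q)
    (fun=> subset_law_ge0 q01) (fun=> subset_law_sum1 n.+1 q)
    (fun=> two_phase_pull) (fun=> two_phase_message) (fun _ _ _ => two_phase_commit).

Variables (u : 'I_k -> {ffun 'I_n.+1 -> bool}).
Variable reward : 'I_k -> 'I_n.+1 -> nat -> R.

Definition votes j : 'I_n.+1 :=
  vote (u j) (play (ucb_pull radius (u j)) (reward j) explore).

Definition fresh_sum j i : R := \sum_(explore <= s < T - explore) reward j i s.

Lemma explore_le : (explore <= T)%N.
Proof. exact: leq_div. Qed.

Lemma two_phase_explore j t : (t <= explore)%N ->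
  play (two_phase_pull (u j)) (reward j) t =
  play (ucb_pull radius (u j)) (reward j) t.
Proof.
move=> te; apply: eq_play_next => h ht.
by rewrite /two_phase_pull (leq_trans ht te).
Qed.

Lemma two_phase_vote j t : (explore <= t)%N ->
  vote (u j) (take explore (play (two_phase_pull (u j)) (reward j) t)) = votes j.
Proof. by move=> et; rewrite take_play// two_phase_explore. Qed.

(** Every pull after exploration goes to the voted arm. At time [T] all rewards of that arm with
    index below [T - explore] have therefore been observed. *)
Lemma two_phase_count j t : (explore <= t)%N ->
  (t - explore <=
   size (rewards_of (votes j) (play (two_phase_pull (u j)) (reward j) t)))%N.
Proof.
elim: t => [|t IH]; first by rewrite sub0n.
rewrite leq_eqVlt => /predU1P[<-|]; first by rewrite subnn.
rewrite ltnS => et; rewrite subSn// count_playS.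
set h := play _ _ t.
have -> : two_phase_pull (u j) h = votes j.
  by rewrite /two_phase_pull size_play ltnNge et /= two_phase_vote.
by rewrite eqxx addn1 ltnS; exact: IH.
Qed.

Lemma two_phase_decision j :
  @decision R k n.+1 2 two_phase T u reward j =
  elect (fun i => [set j' | votes j' == i]%SET)
        (fun j' => fresh_sum j' (votes j') / exploit%:R).
Proof.
rewrite /decision /observed /= /two_phase_commit; congr elect.
  apply/funext => i; apply/setP => j'; rewrite !inE.
  rewrite (tnth_nth 0) /= two_phase_vote ?explore_le//.
  by rewrite eqr_nat.
apply/funext => j'; rewrite (tnth_nth 0) /= two_phase_vote ?explore_le//.
(* By [two_phase_count] the window lies inside the observed prefix of the stream, so the default of
   [nth] is never read. *)
congr (_ / _); apply: eq_big_nat => s /andP[_ sT].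
rewrite rewards_of_play nth_mkseq// (leq_trans sT)// two_phase_count//.
exact: explore_le.
Qed.

End Algorithm.

(** * Maps with countably many values *)

Section DiscreteMeasurability.
Context (d : measure_display) (Omega : measurableType d).

(** Measurability for the discrete sigma-algebra on [S], which is preserved by composition with any
    map out of [S]. *)
Definition dmeasurable (S : Type) (F : Omega -> S) : Prop :=
  forall Y : set S, measurable (F @^-1` Y).

Lemma dmeasurable_cst (S : Type) (s : S) : dmeasurable (cst s).
Proof. by move=> Y; rewrite preimage_cst; case: ifP. Qed.

Lemma dmeasurable_comp (S S' : Type) (g : S -> S') (F : Omega -> S) :
  dmeasurable F -> dmeasurable (g \o F).
Proof. by move=> mF Y; rewrite comp_preimage; exact: mF. Qed.

(** Splitting along the countably many values of [N] replaces the random choice of [F] by a fixed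
    one on each piece. *)
Lemma dmeasurable_bind (S : countType) (S' : Type) (N : Omega -> S)
    (F : S -> Omega -> S') :
  dmeasurable N -> (forall s, dmeasurable (F s)) ->
  dmeasurable (fun w => F (N w) w).
Proof.
move=> mN mF Y.
rewrite (_ : _ @^-1` Y = \bigcup_s (N @^-1` [set s] `&` F s @^-1` Y)).
  apply: countable_bigcupT_measurable; first exact: countableP.
  by move=> s; apply: measurableI; [exact: mN | exact: mF].
apply/seteqP; split => w /= => [Yw|[s _ [/= -> //]]].
by exists (N w).
Qed.

Lemma dmeasurable_ffun (J : finType) (S : countType) (F : J -> Omega -> S) :
  (forall j, dmeasurable (F j)) -> dmeasurable (fun w => [ffun j => F j w]).
Proof.
move=> mF Y.
rewrite (_ : _ @^-1` Y =
    \bigcup_(f in Y) \bigcap_(j in [set: J]) F j @^-1` [set f j]).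
  rewrite bigcup_mkcond; apply: countable_bigcupT_measurable.
    exact: countableP.
  move=> f; case: ifP => // _.
  by apply: fin_bigcap_measurable => // j _; exact: mF.
apply/seteqP; split => w /=.
  by move=> Yw; exists [ffun j => F j w] => // j _ /=; rewrite ffunE.
move=> [f Yf fw]; rewrite (_ : [ffun j => F j w] = f)//.
by apply/ffunP => j; rewrite ffunE; exact: fw.
Qed.

Lemma dmeasurable_ler (R : realType) (f g : Omega -> R) :
  measurable_fun setT f -> measurable_fun setT g ->
  dmeasurable (fun w => f w <= g w).
Proof.
move=> mf mg Y; rewrite -[X in measurable X]setTI.
by apply: measurable_fun_ler.
Qed.

Lemma dmeasurable_argmax (R : realType) n (f : 'I_n.+1 -> Omega -> R) :
  (forall i, measurable_fun setT (f i)) ->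
  dmeasurable (fun w => argmax (fun i => f i w)).
Proof.
move=> mf.
have mle : dmeasurable (fun w => [ffun x => f x.1 w <= f x.2 w]).
  by apply: dmeasurable_ffun => x; apply: dmeasurable_ler.
have := dmeasurable_comp (fun M : {ffun 'I_n.+1 * 'I_n.+1 -> bool} =>
  odflt ord0 [pick i | [forall l, M (l, i)]]) mle.
rewrite /comp; congr dmeasurable; apply/funext => w; rewrite /argmax; congr odflt.
by apply: eq_pick => i; apply: eq_forallb => l; rewrite ffunE.
Qed.

(** Histories contain reals, so the induction follows the vector of pull counts instead. For fixed
    counts the next arm is the argmax of measurable indices, and [dmeasurable_bind] inserts the
    random counts. *)
Lemma dmeasurable_vote (R : realType) n (radius : nat -> R)
    (u : {ffun 'I_n.+1 -> bool}) (r : 'I_n.+1 -> nat -> Omega -> R) T :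
  (forall i s, measurable_fun setT (r i s)) ->
  dmeasurable (fun w => vote u (play (ucb_pull radius u) (fun i s => r i s w) T)).
Proof.
move=> mr; pose h t w := play (ucb_pull radius u) (fun i s => r i s w) t.
pose N t w := [ffun i => size (rewards_of i (h t w))].
have mN t : dmeasurable (N t).
  elim: t => [|t IH].
    rewrite (_ : N 0%N = cst [ffun=> 0%N]); first exact: dmeasurable_cst.
    by apply/funext => w; apply/ffunP => i; rewrite !ffunE.
  pose pulled (v : {ffun 'I_n.+1 -> nat}) w :=
    argmax (ucb_index radius u v (fun i => \sum_(s < v i) r i s w)).
  have mpulled v : dmeasurable (pulled v).
    apply: dmeasurable_argmax => i; rewrite /ucb_index; case: (u i) => //.
    apply: measurable_funD => //; apply: measurable_funM => //.
    exact: measurable_sum.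
  have -> : N t.+1 = fun w => [ffun i => (N t w i + (pulled (N t w) w == i))%N].
    apply/funext => w; apply/ffunP => i; rewrite !ffunE count_playS.
    rewrite ucb_pull_play /pulled; congr (_ + (argmax _ == _))%N.
    by apply/funext => l; rewrite /ucb_index !ffunE.
  apply: (@dmeasurable_bind _ _ (N t)
    (fun v w => [ffun i => (v i + (pulled v w == i))%N])) => // v.
  exact: (dmeasurable_comp (fun l => [ffun i => (v i + (l == i))%N])).
have := dmeasurable_comp (fun v : {ffun 'I_n.+1 -> nat} => most_pulled R u v) (mN T).
congr dmeasurable; apply/funext => w /=; rewrite /vote; congr argmax.
by apply/funext => i; rewrite ffunE.
Qed.

End DiscreteMeasurability.

Section FiniteDecomposition.
Context (d : measure_display) (Omega : measurableType d) (R : realType).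
Variables (P : probability Omega R) (S : finType) (V : Omega -> S).
Hypothesis mV : dmeasurable V.

Lemma measure_fibers (B : set Omega) : measurable B ->
  (P B = \sum_s P (V @^-1` [set s] `&` B))%E.
Proof.
move=> mB.
transitivity (P (\bigcup_(s in [set: S]) (V @^-1` [set s] `&` B))).
  congr (P _); apply/seteqP; split => w /= => [Bw|[s _ []//]].
  by exists (V w).
rewrite measure_fin_bigcup//.
- rewrite (@fsbigE _ _ _ _ _ (index_enum S)) ?index_enum_uniq//.
    by apply: eq_bigl => s; rewrite in_setT.
  by move=> s _; rewrite mem_index_enum.
- exact: finite_finset.
- by move=> s s' _ _ [w [[/= <- _] [/= <- _]]].
- by move=> s _; apply: measurableI => //; exact: mV.
Qed.

End FiniteDecomposition.

Section UnionBound.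
Context (d : measure_display) (Omega : measurableType d) (R : realType).
Variables (P : probability Omega R) (S : eqType) (E : S -> set Omega).
Hypothesis mE : forall s, measurable (E s).

Lemma union_bound (r : seq S) (F : set Omega) : measurable F ->
  (F `<=` [set w | exists2 s, s \in r & E s w]) ->
  (P F <= \sum_(s <- r) P (E s))%E.
Proof.
move=> mF FE; apply: (@le_trans _ _ (P (\big[setU/set0]_(s <- r) E s))).
  apply: le_measure; rewrite ?inE//.
    by apply: bigsetU_measurable => s _; exact: mE.
  move=> w /FE [s sr Ew]; rewrite (big_rem s)//=.
  by left.
elim: r {F mF FE} => [|s r IH]; first by rewrite !big_nil measure0.
rewrite !big_cons; apply: le_trans (leeD2l _ IH).
apply: measureU2; first exact: mE.
by apply: bigsetU_measurable => s' _; exact: mE.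
Qed.

End UnionBound.

(** * Events of the exploration phase *)

Section Bandit.
Context (d : measure_display) (Omega : measurableType d) (R : realType).
Variables (P : probability Omega R) (k n : nat) (p : 'I_n.+1 -> R).
Variable X : 'I_k -> 'I_n.+1 -> nat -> {RV P >-> R}.
Hypothesis banditX : bandit p X.

Notation sample := (fun q : 'I_k * 'I_n.+1 * nat => X q.1.1 q.1.2 q.2).

Let independent_samples : mutually_independent sample :=
  reward_independent banditX.

Lemma mean01 (j0 : 'I_k) i : 0 <= p i <= 1.
Proof.
apply: (@expectation01 _ _ _ P _ sample (p i) [:: (j0, i, 0%N)] _ _ (j0, i, 0%N)).
- by move=> q w _; apply: reward_in01 banditX _ _ _ _.
- by move=> q; rewrite inE => /eqP->; apply: reward_mean banditX _ _ _.
- by rewrite inE.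
Qed.

Section Deviation.
Variables (i : 'I_n.+1) (l : seq ('I_k * 'I_n.+1 * nat)) (eps : R).
Hypotheses (ul : uniq l) (li : forall q, q \in l -> q.1.2 = i) (eps0 : 0 <= eps).

Lemma sample_deviation_upper :
  (P [set w | (size l)%:R * (p i + eps) <= \sum_(q <- l) sample q w]%R <=
   (expR (- ((size l)%:R * eps ^+ 2 / 8)))%:E)%E.
Proof.
apply: (deviation_upper independent_samples) => // [q w _|q /li <-].
  exact: reward_in01 banditX _ _ _ _.
exact: reward_mean banditX _ _ _.
Qed.

Lemma sample_deviation_lower :
  (P [set w | \sum_(q <- l) sample q w <= (size l)%:R * (p i - eps)]%R <=
   (expR (- ((size l)%:R * eps ^+ 2 / 8)))%:E)%E.
Proof.
apply: (deviation_lower independent_samples) => // [q w _|q /li <-].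
  exact: reward_in01 banditX _ _ _ _.
exact: reward_mean banditX _ _ _.
Qed.

End Deviation.

Lemma dependent_dmeasurable (D : pred ('I_k * 'I_n.+1 * nat)) (S : Type)
    (F : Omega -> S) Y :
  dmeasurable (F : g_sigma_algebraType (cylinders sample D) -> S) ->
  depends_on sample D (F @^-1` Y).
Proof. by move=> mF; apply: mF. Qed.

Section Explore.
Variables (radius : nat -> R) (T1 : nat).

Definition confident j w : bool :=
  [forall x : 'I_n.+1 * 'I_T1,
    `|(\sum_(s < x.2.+1) X j x.1 s w) / x.2.+1%:R - p x.1| <= radius x.2.+1].

(** All samples that player [j] can meet during exploration, whichever arms it pulls. *)
Definition early j : pred ('I_k * 'I_n.+1 * nat) :=
  fun q => (q.1.1 == j) && (q.2 < T1)%N.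

Lemma confident_depends j Y : depends_on sample (early j) (confident j @^-1` Y).
Proof.
apply: dependent_dmeasurable.
pose C w := [ffun x : 'I_n.+1 * 'I_T1 =>
    `|(\sum_(s < x.2.+1) X j x.1 s w) / x.2.+1%:R - p x.1| <= radius x.2.+1].
have mC : dmeasurable (C : g_sigma_algebraType (cylinders sample (early j)) -> _).
  apply: dmeasurable_ffun => x; apply: dmeasurable_ler => //.
  apply: measurableT_comp => //; apply: measurable_funB => //.
  apply: measurable_funM => //.
  apply: (@measurable_sum _ (g_sigma_algebraType (cylinders sample (early j)))) => s.
  apply: (@depends_on_measurable_fun _ _ _ _ _ sample (early j) (j, x.1, s : nat)).
  by rewrite /early /= eqxx (leq_trans (ltn_ord s)).
have := dmeasurable_comp (fun c : {ffun 'I_n.+1 * 'I_T1 -> bool} => [forall x, c x]) mC.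
congr dmeasurable; apply/funext => w /=; rewrite /confident.
by apply: eq_forallb => x; rewrite ffunE.
Qed.

Lemma vote_depends u j Y :
  depends_on sample (early j)
    ((fun w => vote u (play (ucb_pull radius u) (fun i s => X j i s w) T1)) @^-1` Y).
Proof.
apply: dependent_dmeasurable.
(* Rewards of index at least [T1] are never read, so replacing them by 0 leaves the vote unchanged
   and makes every reward measurable for the early samples. *)
pose r i s : Omega -> R := if (s < T1)%N then X j i s else cst 0.
have -> : (fun w => vote u (play (ucb_pull radius u) (fun i s => X j i s w) T1)) =
          (fun w => vote u (play (ucb_pull radius u) (fun i s => r i s w) T1)).
  apply/funext => w; congr (vote _ _); apply: eq_play_reward => i s sT.
  by rewrite /r sT.
apply: dmeasurable_vote => i s; rewrite /r; case: ifP => // sT.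
apply: (@depends_on_measurable_fun _ _ _ _ _ sample (early j) (j, i, s)).
by rewrite /early /= eqxx sT.
Qed.

(** A union bound over arms, sample sizes and the two tails. The sample sizes are deterministic, as
    the event concerns the reward streams and not the adaptive pulls. *)
Lemma confident_prob j (beta : R) : (forall t, 0 <= radius t) ->
  \sum_(t < T1) n.+1%:R * (expR (- (t.+1%:R * radius t.+1 ^+ 2 / 8)) *+ 2) <= beta ->
  (P (confident j @^-1` [set false]) <= beta%:E)%E.
Proof.
move=> radius0 tail.
pose idx (i : 'I_n.+1) t := [seq (j, i, s) | s <- iota 0 t].
have sum_idx i t w : \sum_(q <- idx i t) sample q w = \sum_(s < t) X j i s w.
  by rewrite /idx big_map -(big_mkord xpredT (fun s => X j i s w)) /index_iota subn0.
have uidx i t : uniq (idx i t).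
  by rewrite map_inj_uniq ?iota_uniq// => s s' [].
have iidx i t q : q \in idx i t -> q.1.2 = i by case/mapP => s _ ->.
have sidx i t : size (idx i t) = t by rewrite size_map size_iota.
pose up (x : 'I_n.+1 * 'I_T1) := [set w | x.2.+1%:R * (p x.1 + radius x.2.+1) <=
  \sum_(q <- idx x.1 x.2.+1) sample q w]%R.
pose low (x : 'I_n.+1 * 'I_T1) := [set w | \sum_(q <- idx x.1 x.2.+1) sample q w <=
  x.2.+1%:R * (p x.1 - radius x.2.+1)]%R.
have mup x : measurable (up x) by exact: measurable_sum_ge.
have mlow x : measurable (low x) by exact: measurable_sum_le.
have cover : confident j @^-1` [set false] `<=`
    [set w | exists2 x, x \in index_enum _ & (up x `|` low x) w].
  move=> w /= /negbT; rewrite negb_forall => /existsP[x].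
  rewrite ler_norml negb_and -!ltNge => xw.
  exists x; first exact: mem_index_enum.
  have t0 : 0 < x.2.+1%:R :> R by rewrite ltr0n.
  rewrite /up /low /= !sum_idx; case/orP: xw => xw; [right|left].
    by move: xw; rewrite ltrBlDr ltr_pdivrMr// mulrC addrC => /ltW.
  by move: xw; rewrite ltrBrDr ltr_pdivlMr// mulrC addrC => /ltW.
have mul x : measurable (up x `|` low x) by exact: measurableU.
have mc : measurable (confident j @^-1` [set false]).
  by apply: (@depends_on_measurable _ _ _ _ _ sample (early j)); exact: confident_depends.
apply: le_trans (union_bound P mul mc cover) _.
pose bound (t : nat) : R := expR (- (t.+1%:R * radius t.+1 ^+ 2 / 8)) *+ 2.
apply: (@le_trans _ _ (\sum_(x : 'I_n.+1 * 'I_T1) (bound x.2)%:E)%E).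
  apply: lee_sum => x _; apply: le_trans (measureU2 P (mup x) (mlow x)) _.
  rewrite /bound mulr2n EFinD; apply: leeD.
    have := sample_deviation_upper (uidx x.1 x.2.+1) (iidx x.1 _) (radius0 x.2.+1).
    by rewrite sidx.
  have := sample_deviation_lower (uidx x.1 x.2.+1) (iidx x.1 _) (radius0 x.2.+1).
  by rewrite sidx.
rewrite sumEFin lee_fin; apply: le_trans tail.
rewrite -(pair_bigA _ (fun i (t : 'I_T1) => bound t)) /= exchange_big /=.
by apply: ler_sum => t _; rewrite sumr_const card_ord mulr_natl.
Qed.

End Explore.

End Bandit.

(** * Events of the exploitation phase *)

Section Exploit.
Context (d : measure_display) (Omega : measurableType d) (R : realType).
Variables (P : probability Omega R) (k n : nat) (p : 'I_n.+1 -> R).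
Variable X : 'I_k -> 'I_n.+1 -> nat -> {RV P >-> R}.
Hypothesis banditX : bandit p X.
Variables (theta : R) (t0 t1 : nat) (b : 'I_n.+1).
Hypotheses (theta_ge0 : 0 <= theta) (t01 : (t0 < t1)%N).
Hypothesis best : unique_best p b.

Notation sample := (fun q : 'I_k * 'I_n.+1 * nat => X q.1.1 q.1.2 q.2).

Definition late : pred ('I_k * 'I_n.+1 * nat) := fun q => (t0 <= q.2)%N.

Definition voters (c : {ffun 'I_k -> 'I_n.+1}) i : {set 'I_k} :=
  [set j | c j == i]%SET.

Definition estimate (c : {ffun 'I_k -> 'I_n.+1}) i w : R :=
  (\sum_(j in voters c i)
     (\sum_(t0 <= s < t1) X j (c j) s w) / (t1 - t0)%:R) / #|voters c i|%:R.

(** The vote vector [c] is deterministic here, so that the event depends on late samples only. *)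
Definition misleading c w : bool :=
  [exists i, [&& i != b, theta < #|voters c i|%:R, theta < #|voters c b|%:R
             & estimate c b w <= estimate c i w]].

Let idx c i := [seq (j, i, s) | j <- enum (voters c i), s <- index_iota t0 t1].

Let size_idx c i : size (idx c i) = (#|voters c i| * (t1 - t0))%N.
Proof. by rewrite size_allpairs -cardE size_iota. Qed.

Let uniq_idx c i : uniq (idx c i).
Proof.
apply: allpairs_uniq; [exact: enum_uniq | exact: iota_uniq|].
by move=> [j s] [j' s'] _ _ [-> ->].
Qed.

Let arm_idx c i q : q \in idx c i -> q.1.2 = i.
Proof. by case/allpairsP => -[j s] [_ _ ->]. Qed.

Let late_idx c i q : q \in idx c i -> late q.
Proof.
by case/allpairsP => -[j s] [_ /=]; rewrite mem_index_iota => /andP[+ _] ->.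
Qed.

Lemma estimateE c i w :
  estimate c i w = (\sum_(q <- idx c i) sample q w) / (size (idx c i))%:R.
Proof.
rewrite size_idx natrM invfM mulrA mulrAC /estimate -mulr_suml; congr (_ / _ / _).
rewrite big_allpairs_dep big_enum /=; apply: eq_bigr => j.
by rewrite inE => /eqP->.
Qed.

Lemma estimate_ge0 c i w : 0 <= estimate c i w.
Proof.
rewrite estimateE divr_ge0//; apply: sumr_ge0 => q _.
by case/andP: (reward_in01 banditX q.1.1 q.1.2 q.2 w).
Qed.

Lemma misleading_depends c Y : depends_on sample late (misleading c @^-1` Y).
Proof.
apply: dependent_dmeasurable.
pose C w := [ffun i => estimate c b w <= estimate c i w].
have mE i : measurable_fun setT
    (estimate c i : g_sigma_algebraType (cylinders sample late) -> R).
  rewrite (_ : estimate c i = fun w =>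
    (\sum_(q <- idx c i) sample q w) / (size (idx c i))%:R); last first.
    by apply/funext => w; rewrite estimateE.
  apply: measurable_funM => //; apply: measurable_fun_sum_in => q /late_idx lq.
  exact: depends_on_measurable_fun.
have mC : dmeasurable (C : g_sigma_algebraType (cylinders sample late) -> _).
  by apply: dmeasurable_ffun => i; apply: dmeasurable_ler.
have := dmeasurable_comp (fun m : {ffun 'I_n.+1 -> bool} =>
  [exists i, [&& i != b, theta < #|voters c i|%:R, theta < #|voters c b|%:R
             & m i]]) mC.
congr dmeasurable; apply/funext => w /=; rewrite /misleading.
by apply: eq_existsb => i; rewrite ffunE.
Qed.

Definition misleading_bound : R :=
  \sum_(i | i != b)
    expR (- (theta * (t1 - t0)%:R * (p b - p i) ^+ 2 / 32)) *+ 2.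

(** If [i] looks at least as good as [b], one of the two estimates is off by half the gap. Each is a
    mean over more than [theta * (t1 - t0)] samples, and [(gap / 2)^2 / 8 = gap^2 / 32]. *)
Lemma misleading_prob c :
  (P (misleading c @^-1` [set true]) <= misleading_bound%:E)%E.
Proof.
pose eps i := (p b - p i) / 2.
pose up i := [set w | (size (idx c i))%:R * (p i + eps i) <=
                      \sum_(q <- idx c i) sample q w].
pose low i := [set w | \sum_(q <- idx c b) sample q w <=
                       (size (idx c b))%:R * (p b - eps i)].
pose E i := if [&& i != b, theta < #|voters c i|%:R & theta < #|voters c b|%:R]
            then up i `|` low i else set0.
have mup i : measurable (up i) by exact: measurable_sum_ge.
have mlow i : measurable (low i) by exact: measurable_sum_le.
have mE i : measurable (E i).
  by rewrite /E; case: ifP => // _; exact: measurableU.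
have size_gt0 i : theta < #|voters c i|%:R -> 0 < (size (idx c i))%:R :> R.
  move=> ti; rewrite size_idx ltr0n muln_gt0 subn_gt0 t01 andbT -(ltr_nat R).
  exact: le_lt_trans ti.
have cover : misleading c @^-1` [set true] `<=`
    [set w | exists2 i, i \in index_enum _ & E i w].
  move=> w /= /existsP[i /and4P[ib ti tb est]].
  exists i; first exact: mem_index_enum.
  rewrite /E ib ti tb /=; apply/orP; rewrite /up /low /=.
  apply/orP; case: (leP (p i + eps i) (estimate c i w)) => [|hi].
    by rewrite estimateE ler_pdivlMr ?size_gt0// mulrC; left.
  right; rewrite mulrC -ler_pdivrMr ?size_gt0// -estimateE (le_trans est)//.
  by apply/ltW/(lt_le_trans hi); rewrite /eps; lra.
have mm : measurable (misleading c @^-1` [set true]).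
  exact: depends_on_measurable (misleading_depends c _).
apply: le_trans (union_bound P mE mm cover) _.
rewrite (bigID (fun i => i != b)) /= [X in (_ + X)%E]big1 ?adde0; last first.
  by move=> i /negbTE ib; rewrite /E ib measure0.
rewrite /misleading_bound -sumEFin; apply: lee_sum => i ib.
rewrite /E ib /=; case: ifP => [/andP[ti tb]|_]; last first.
  by rewrite measure0 lee_fin mulrn_wge0// expR_ge0.
have eps0 : 0 <= eps i by rewrite divr_ge0// subr_ge0 ltW// best.
have exp_le l : theta < #|voters c l|%:R ->
    expR (- ((size (idx c l))%:R * eps i ^+ 2 / 8)) <=
    expR (- (theta * (t1 - t0)%:R * (p b - p i) ^+ 2 / 32)).
  move=> tl; rewrite ler_expR lerN2 size_idx natrM.
  rewrite (_ : eps i ^+ 2 = (p b - p i) ^+ 2 / 4); last by rewrite /eps; field.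
  have : 0 <= (t1 - t0)%:R * (p b - p i) ^+ 2 by rewrite mulr_ge0// sqr_ge0.
  by move=> /ler_wpM2r/(_ _ _ (ltW tl)); lra.
apply: le_trans (measureU2 P (mup i) (mlow i)) _.
rewrite mulr2n EFinD; apply: leeD.
  apply: le_trans (sample_deviation_upper banditX (@uniq_idx c i) (@arm_idx c i) eps0) _.
  by rewrite lee_fin exp_le.
apply: le_trans (sample_deviation_lower banditX (@uniq_idx c b) (@arm_idx c b) eps0) _.
by rewrite lee_fin exp_le.
Qed.

Lemma elect_best c w : theta < #|voters c b|%:R -> ~~ misleading c w ->
  elect theta (voters c)
    (fun j => (\sum_(t0 <= s < t1) X j (c j) s w) / (t1 - t0)%:R) = b.
Proof.
move=> tb nm; apply: argmax_unique => i ib; rewrite tb -!/(estimate c _ w).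
case: ifP => [ti|_].
  rewrite ltNge; apply: contra nm => est; apply/existsP; exists i.
  by rewrite ib ti tb.
by rewrite (lt_le_trans (ltrN10 _))// estimate_ge0.
Qed.

Lemma dmeasurable_elect c : dmeasurable (fun w => elect theta (voters c)
    (fun j => (\sum_(t0 <= s < t1) X j (c j) s w) / (t1 - t0)%:R)).
Proof.
apply: dmeasurable_argmax => i; case: (theta < _) => //.
apply: measurable_funM => //; under eq_fun do rewrite -big_enum.
apply: measurable_sum => j.
by apply: measurable_funM => //; apply: measurable_sum.
Qed.

End Exploit.

(** * Success for fixed seeds *)

Section FixedSeed.
Context (d : measure_display) (Omega : measurableType d) (R : realType).
Variables (P : probability Omega R) (k n : nat) (p : 'I_n.+1 -> R).
Variable X : 'I_k -> 'I_n.+1 -> nat -> {RV P >-> R}.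
Hypothesis banditX : bandit p X.
Variables (b : 'I_n.+1) (radius : nat -> R) (theta beta : R) (T : nat).
Hypotheses (best : unique_best p b) (theta_ge0 : 0 <= theta).
Hypothesis T_gt0 : (0 < T)%N.
(** [ok] stands for the subsets of arms on which a confident player is certain to vote for [b]. *)
Variable ok : pred {ffun 'I_n.+1 -> bool}.
Hypothesis ok_vote : forall u j w, ok u ->
  confident p X radius (explore T) j w ->
  vote u (play (ucb_pull radius u) (fun i s => X j i s w) (explore T)) = b.
Hypothesis confidentP : forall j,
  (P (confident p X radius (explore T) j @^-1` [set false]) <= beta%:E)%E.
Variable u : 'I_k -> {ffun 'I_n.+1 -> bool}.

Notation sample := (fun q : 'I_k * 'I_n.+1 * nat => X q.1.1 q.1.2 q.2).
Notation T1 := (explore T).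

Let independent_samples : mutually_independent sample :=
  reward_independent banditX.

Let T1_lt : (T1 < T - T1)%N.
Proof. by rewrite /explore; lia. Qed.

Definition vote_vector w : {ffun 'I_k -> 'I_n.+1} :=
  [ffun j => votes radius T u (fun j i s => X j i s w) j].

Lemma vote_vector_depends c :
  depends_on sample (fun q => (q.2 < T1)%N) (vote_vector @^-1` [set c]).
Proof.
rewrite (_ : _ @^-1` _ = \bigcap_(j in [set: 'I_k])
  ((fun w => votes radius T u (fun j i s => X j i s w) j) @^-1` [set c j])).
  apply: (@fin_bigcap_measurable _
    (g_sigma_algebraType (cylinders sample (fun q => (q.2 < T1)%N)))).
    exact: finite_finset.
  move=> j _.
  have sub : {subset @early k n T1 j <= (fun q => (q.2 < T1)%N)} by move=> q; case/andP.
  exact: depends_on_subset sub (vote_depends radius (u j) [set c j]).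
apply/seteqP; split => w /=; first by move=> <- j _; rewrite /= ffunE.
by move=> h; apply/ffunP => j; rewrite ffunE; exact: h.
Qed.

Lemma dmeasurable_vote_vector : dmeasurable vote_vector.
Proof.
apply: dmeasurable_ffun => j Y.
exact: depends_on_measurable (vote_depends radius (u j) Y).
Qed.

Definition mislead w : bool :=
  misleading X theta T1 (T - T1) b (vote_vector w) w.

Lemma measurable_mislead : measurable (mislead @^-1` [set true]).
Proof.
apply: (@dmeasurable_bind _ _ _ _ vote_vector
  (misleading X theta T1 (T - T1) b)) => [|c Y]; first exact: dmeasurable_vote_vector.
exact: depends_on_measurable (misleading_depends _ _ _ c Y).
Qed.

(** Summing over the values [c] of the vote vector: the votes depend on indices below [T1] and
    [misleading c] on later ones, so each term is at most the bound times the probability of [c]. *)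
Lemma mislead_prob :
  (P (mislead @^-1` [set true]) <=
   (misleading_bound p theta T1 (T - T1) b)%:E)%E.
Proof.
set B := misleading_bound _ _ _ _ _.
rewrite (measure_fibers P dmeasurable_vote_vector measurable_mislead).
apply: (@le_trans _ _ (\sum_c (B%:E * P (vote_vector @^-1` [set c] `&` setT)))%E).
  apply: lee_sum => c _; rewrite setIT.
  rewrite (_ : _ `&` _ = vote_vector @^-1` [set c] `&`
    (misleading X theta T1 (T - T1) b c @^-1` [set true])); last first.
    by apply/seteqP; split => w /= [<-].
  rewrite (disjoint_independence independent_samples _ (vote_vector_depends c)
    (misleading_depends _ _ _ c _)); last first.
    by move=> q /=; rewrite /late -ltnNge.
  by rewrite muleC; apply: lee_wpmul2r => //; exact: misleading_prob.
rewrite -ge0_sume_distrr// -(measure_fibers P dmeasurable_vote_vector)//.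
by rewrite [P _]probability_setT mule1.
Qed.

Definition good w : {set 'I_k} := [set j | ok (u j) & confident p X radius T1 j w]%SET.

Definition pattern w : {ffun 'I_k -> bool} :=
  [ffun j => confident p X radius T1 j w].

Lemma dmeasurable_pattern : dmeasurable pattern.
Proof.
apply: dmeasurable_ffun => j Y.
exact: depends_on_measurable (confident_depends p radius Y).
Qed.

Definition few_good w : bool := #|good w|%:R <= theta.

Lemma dmeasurable_few_good : dmeasurable few_good.
Proof.
have := dmeasurable_comp (fun g : {ffun 'I_k -> bool} =>
  #|[set j | ok (u j) & g j]%SET|%:R <= theta) dmeasurable_pattern.
congr dmeasurable; apply/funext => w /=; rewrite /few_good /good.
by congr (_%:R <= _); apply: eq_card => j; rewrite !inE ffunE.
Qed.

Let prob j x : R := fine (P (confident p X radius T1 j @^-1` [set x])).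

Let measurable_confident j x : measurable (confident p X radius T1 j @^-1` [set x]).
Proof. exact: depends_on_measurable (confident_depends p radius _). Qed.

Let probE j x : (prob j x)%:E = P (confident p X radius T1 j @^-1` [set x]).
Proof. by rewrite fineK// fin_num_measure. Qed.

Let prob_ge0 j x : 0 <= prob j x. Proof. by rewrite fine_ge0. Qed.

Let prob_sum j : prob j true = 1 - prob j false.
Proof.
apply: EFin_inj; rewrite EFinB !probE -probability_setC//; congr (P _).
by apply/seteqP; split => w /=; case: confident.
Qed.

Lemma pattern_prob g : P (pattern @^-1` [set g]) = (\prod_j prob j (g j))%:E.
Proof.
rewrite -prodEFin; under eq_bigr do rewrite probE.
rewrite -(@disjoint_independence_seq _ _ _ _ _ _ independent_samples _
  (@early k n T1) (fun j => confident p X radius T1 j @^-1` [set g j]));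
  rewrite ?index_enum_uniq//.
- congr (P _); apply/seteqP; split => w /=; first by move=> <- j _; rewrite /= ffunE.
  by move=> h; apply/ffunP => j; rewrite ffunE; apply: h; exact: mem_index_enum.
- by move=> j j' q /andP[/eqP<- _] /andP[/eqP<- _].
- by move=> j; exact: confident_depends.
Qed.

(* Chernoff: the exponential moment of order [s] factorizes over the players. *)
Lemma few_good_prob (s : R) : 0 <= s ->
  (P (few_good @^-1` [set true]) <=
   (expR (s * theta) *
    \prod_j (1 - (ok (u j))%:R * ((1 - beta) * (1 - expR (- s)))))%:E)%E.
Proof.
move=> s0; rewrite (measure_fibers P dmeasurable_pattern); last exact: dmeasurable_few_good.
pose cost j (x : bool) := expR (- (s * (ok (u j) && x)%:R)).
apply: (@le_trans _ _ (\sum_(g : {ffun 'I_k -> bool})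
    (expR (s * theta) * \prod_j (cost j (g j) * prob j (g j)))%:E)%E).
  apply: lee_sum => g _.
  have [gle|glt] := leP (#|[set j | ok (u j) & g j]%SET|%:R) theta; last first.
    rewrite (_ : _ `&` _ = set0) ?measure0.
      rewrite lee_fin mulr_ge0 ?expR_ge0//; apply: prodr_ge0 => j _.
      by rewrite mulr_ge0// expR_ge0.
    apply/seteqP; split => // w /= [wg]; move: glt; rewrite ltNge => /negP.
    rewrite /few_good /good -wg; congr (~ (_%:R <= _)).
    by apply: eq_card => j; rewrite !inE ffunE.
  apply: (@le_trans _ _ (P (pattern @^-1` [set g]))).
    apply: le_measure; rewrite ?inE//.
      apply: measurableI; first exact: dmeasurable_pattern.
      exact: dmeasurable_few_good.
    exact: dmeasurable_pattern.
  (* At most [theta] players are good in [g], so [expR (s * theta)] times all the costs is the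
     exponential of a nonnegative number. *)
  rewrite pattern_prob lee_fin big_split /= mulrA ler_peMl ?prodr_ge0//.
  rewrite -expR_sum -expRD -[leLHS]expR0 ler_expR.
  rewrite sumrN -mulr_sumr -mulrBr mulr_ge0// subr_ge0 (le_trans _ gle)//.
  rewrite -natr_sum ler_nat -sum1_card [leqRHS]big_mkcond /=.
  by apply: leq_sum => j _; rewrite inE; case: (_ && _).
rewrite sumEFin lee_fin -mulr_sumr ler_wpM2l ?expR_ge0//.
rewrite -(bigA_distr_bigA (fun j x => cost j x * prob j x)) /=.
apply: ler_prod => j _; rewrite big_bool /= /cost.
(* With [y] the probability that [j] is not confident, its factor is [1 - (1 - y) (1 - expR (- s))]
   when [u j] is [ok], and 1 otherwise. *)
rewrite !andbT !andbF mulr0 oppr0 expR0 mul1r prob_sum.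
apply/andP; split.
  by rewrite addr_ge0// mulr_ge0 ?expR_ge0// -prob_sum.
have pb : prob j false <= beta by rewrite -lee_fin probE.
have es : expR (- s) <= 1 by rewrite -expR0 ler_expR lerNl oppr0.
case: (ok (u j)); rewrite ?mulr1 ?mulr0 ?oppr0 ?expR0 ?mul0r ?mul1r; nra.
Qed.

Variables (q : R) (q01 : 0 <= q <= 1).

(** All players reach the same decision. The player [j0] is needed because with no players the event
    would hold vacuously. *)
Lemma success_eventE (j0 : 'I_k) (v : {ffun 'I_k -> {ffun 'I_n.+1 -> bool}}) :
  v = u :> (_ -> _) ->
  @success_event R k n.+1 2 (two_phase k n radius theta T q01) T _ _ P X b v =
  [set w | elect theta (voters (vote_vector w)) (fun j =>
     (\sum_(T1 <= s < T - T1) X j (vote_vector w j) s w) / (T - T1 - T1)%:R) = b].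
Proof.
move=> vu.
have decE w j :
  @decision R k n.+1 2 (two_phase k n radius theta T q01) T v (fun j i s => X j i s w) j =
  elect theta (voters (vote_vector w)) (fun j =>
     (\sum_(T1 <= s < T - T1) X j (vote_vector w j) s w) / (T - T1 - T1)%:R).
  rewrite vu two_phase_decision; congr elect.
    by apply/funext => i; apply/setP => j'; rewrite !inE ffunE.
  by apply/funext => j'; rewrite ffunE.
apply/seteqP; split => w /=; first by move=> /(_ j0); rewrite decE.
by move=> h j; rewrite decE.
Qed.

Lemma measurable_success_event (j0 : 'I_k)
    (v : {ffun 'I_k -> {ffun 'I_n.+1 -> bool}}) : v = u :> (_ -> _) ->
  measurable (@success_event R k n.+1 2 (two_phase k n radius theta T q01) T _ _ P X b v).
Proof.
move=> vu; rewrite (success_eventE j0 vu).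
apply: (@dmeasurable_bind _ _ _ _ vote_vector (fun c w =>
  elect theta (voters c) (fun j =>
     (\sum_(T1 <= s < T - T1) X j (c j) s w) / (T - T1 - T1)%:R)) _ _ [set b]).
  exact: dmeasurable_vote_vector.
by move=> c; exact: dmeasurable_elect.
Qed.

(** Good players vote for [b]; hence if more than [theta] of them exist and the estimates do not
    mislead, [b] is elected. *)
Lemma success_event_prob (j0 : 'I_k)
    (v : {ffun 'I_k -> {ffun 'I_n.+1 -> bool}}) (s : R) : v = u :> (_ -> _) -> 0 <= s ->
  ((1 - (expR (s * theta) *
      \prod_j (1 - (ok (u j))%:R * ((1 - beta) * (1 - expR (- s)))))
    - misleading_bound p theta T1 (T - T1) b)%:E <=
   P (@success_event R k n.+1 2 (two_phase k n radius theta T q01) T _ _ P X b v))%E.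
Proof.
move=> vu s0; have mS := measurable_success_event j0 vu.
set S := success_event _ _ _ _ in mS *.
set F := few_good @^-1` [set true]; set M := mislead @^-1` [set true].
have mF : measurable F by exact: dmeasurable_few_good.
have mM : measurable M by exact: measurable_mislead.
have SFM : ~` S `<=` F `|` M.
  move=> w; apply: contra_notP => /not_orP[/= /negP nF /negP nM].
  rewrite /S (success_eventE j0 vu) /=; apply: (elect_best banditX _ nM).
  rewrite /few_good -ltNge in nF; apply: lt_le_trans nF _.
  rewrite ler_nat; apply/subset_leq_card/fintype.subsetP => j.
  rewrite !inE ffunE => /andP[okj cj].
  by apply/eqP; exact: ok_vote cj.
have PSC : (P (~` S) <= P F + P M)%E.
  apply: le_trans (measureU2 P mF mM).
  by apply: le_measure => //; rewrite inE//; [exact: measurableC|exact: measurableU].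
have := le_trans PSC (leeD (few_good_prob s0) mislead_prob).
rewrite probability_setC// -EFinD.
have -> : P S = (fine (P S))%:E by rewrite fineK// fin_num_measure.
rewrite -EFinB !lee_fin; lra.
Qed.

End FixedSeed.

(** * Confidence radii and random subsets of arms *)

Section Radius.
Variables (R : realType) (N : nat) (a : R).
Hypotheses (N_gt0 : (0 < N)%N) (a_ge1 : 1 <= a).

(** Chosen so that each deviation bound equals [expR (- a) / (N (t+1)^2)], which is summable over
    the [N] arms and all [t]. *)
Definition ucb_radius (t : nat) : R :=
  if t is 0 then 1
  else Num.sqrt (8 * (ln N%:R + 2 * ln t.+1%:R + a) / t%:R).

Let lnN_ge0 : 0 <= ln (N%:R : R). Proof. by rewrite ln_ge0// ler1n. Qed.

Lemma ucb_radius_ge0 t : 0 <= ucb_radius t.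
Proof. by case: t => // t; exact: sqrtr_ge0. Qed.

Lemma ucb_radius_sqr t : (0 < t)%N ->
  t%:R * ucb_radius t ^+ 2 = 8 * (ln N%:R + 2 * ln t.+1%:R + a).
Proof.
case: t => // t _; have t0 : t.+1%:R != 0 :> R by rewrite pnatr_eq0.
have lnt : 0 <= ln (t.+2%:R : R) by rewrite ln_ge0// ler1n.
rewrite /ucb_radius sqr_sqrtr; first by rewrite mulrC divfK.
have lnN := lnN_ge0; rewrite divr_ge0// mulr_ge0//.
by rewrite !addr_ge0 ?mulr_ge0// (le_trans ler01).
Qed.

Lemma sum_inv_sqr_le1 T : \sum_(t < T) (t.+2%:R ^+ 2)^-1 <= 1 :> R.
Proof.
(* The sharper bound telescopes, since [1/(x+1)^2 <= 1/x - 1/(x+1)]. *)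
suff: \sum_(t < T) (t.+2%:R ^+ 2)^-1 <= 1 - T.+1%:R^-1 :> R.
  by move/le_trans; apply; rewrite gerBl invr_ge0.
elim: T => [|T IH]; first by rewrite big_ord0 invr1 subrr.
rewrite big_ord_recr /=; apply: le_trans (lerD IH (lexx _)) _.
have x0 : 0 < T.+1%:R :> R by rewrite ltr0n.
rewrite -[T.+2%:R]natr1; set x : R := T.+1%:R in x0 *.
suff : ((x + 1) ^+ 2)^-1 <= x^-1 - (x + 1)^-1.
  by move: x^-1 (x + 1)^-1 ((x + 1) ^+ 2)^-1 => y z v; lra.
have -> : x^-1 - (x + 1)^-1 = (x * (x + 1))^-1.
  by field; rewrite !gt_eqF//; lra.
by rewrite lef_pV2 ?posrE ?mulr_gt0 ?exprn_gt0//; nra.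
Qed.

Lemma ucb_radius_tail T :
  \sum_(t < T) N%:R * (expR (- (t.+1%:R * ucb_radius t.+1 ^+ 2 / 8)) *+ 2) <=
  expR (- a) *+ 2.
Proof.
rewrite (eq_bigr (fun t : 'I_T => expR (- a) *+ 2 * (t.+2%:R ^+ 2)^-1)).
  rewrite -mulr_sumr -[leRHS]mulr1 ler_wpM2l ?mulrn_wge0 ?expR_ge0//.
  exact: sum_inv_sqr_le1.
move=> t _; rewrite ucb_radius_sqr// mulrAC divff// mul1r.
have N0 : 0 < N%:R :> R by rewrite ltr0n.
rewrite !opprD !expRD !expRN lnK ?posrE//.
rewrite (_ : 2 * ln _ = ln (t.+2%:R ^+ 2)); last by rewrite lnXn ?ltr0n// mulr_natl.
rewrite lnK ?posrE ?exprn_gt0 ?ltr0n//.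
by rewrite !mulr2n; field; rewrite !gt_eqF ?expR_gt0 ?ltr0n.
Qed.

(* Bounds the number of pulls of an arm of gap [D]: it solves
   [D <= 2 * ucb_radius t] for [t]. *)
Definition pull_count (D : R) : R := 10 ^+ 3 * (a + ln (N%:R / D)) / D ^+ 2.

Lemma pull_count_ge1 D : 0 < D <= 1 -> 1 <= pull_count D.
Proof.
move=> /andP[D0 D1]; rewrite /pull_count ler_pdivlMr ?exprn_gt0// mul1r.
have : 0 <= ln (N%:R / D).
  by rewrite ln_ge0// ler_pdivlMr// mul1r (le_trans D1)// ler1n.
have : D ^+ 2 <= 1 by nra.
move: (ln _) (D ^+ 2) a_ge1 => y z; lra.
Qed.

(** Squaring gives [t D^2 <= 32 (ln N + 2 ln (t+1) + a)]. The divisor 128 makes the term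
    [64 ln (t+1)] cost half of [(t+1) D^2]; the remaining constants fit in [10^3] because
    [a >= 1]. *)
Lemma ucb_radius_pull_count D t : 0 < D <= 1 -> (0 < t)%N ->
  D <= ucb_radius t *+ 2 -> t.+1%:R <= pull_count D.
Proof.
move=> /andP[D0 D1] t0 Dr; have D20 : 0 < D ^+ 2 by rewrite exprn_gt0.
rewrite /pull_count ler_pdivlMr//.
have N0 : 0 < N%:R :> R by rewrite ltr0n.
have -> : ln (N%:R / D) = ln N%:R - ln D by rewrite ln_div ?posrE.
have D2r : D ^+ 2 <= 4 * ucb_radius t ^+ 2.
  have := ucb_radius_ge0 t; move: Dr; rewrite mulr2n; nra.
have := ucb_radius_sqr t0.
have lnD : ln D <= 0 by rewrite ln_le0.
have t1 : 0 < t.+1%:R :> R by rewrite ltr0n.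
(* [ln y <= y - 1] at [y = (t + 1) D^2 / 128] *)
have lnt : ln t.+1%:R <= t.+1%:R * D ^+ 2 / 128 + 6 - 2 * ln D.
  have -> : ln t.+1%:R = ln (t.+1%:R * D ^+ 2 / 128) + ln 128 - 2 * ln D.
    by rewrite ln_div ?posrE ?mulr_gt0// lnM ?posrE// lnXn// mulr2n; lra.
  have := @le_ln1Dx R (t.+1%:R * D ^+ 2 / 128 - 1).
  have ln2 : ln 2 <= 1 :> R by have := @le_ln1Dx R 1; apply; lra.
  have ln128 : ln 128 = ln 2 *+ 7 :> R by rewrite -lnXn//; congr ln; ring.
  rewrite [1 + (_ - 1)]addrC subrK.
  have y0 : 0 < t.+1%:R * D ^+ 2 / 128 by rewrite divr_gt0// mulr_gt0.
  by move=> h; have := h ltac:(lra); rewrite ln128; lra.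
have tt : t.+1%:R = t%:R + 1 :> R by rewrite natr1.
rewrite tt in t1 lnt *.
have tr : 0 <= (t%:R : R) by [].
have D21 : D ^+ 2 <= 1 by nra.
have : t%:R * D ^+ 2 <= 4 * (t%:R * ucb_radius t ^+ 2) by nra.
move: lnt D21 lnD lnN_ge0 a_ge1; rewrite mulrDl mul1r.
move: (ln _) (ln _) (ln _) (t%:R * D ^+ 2) (D ^+ 2) (t%:R * ucb_radius t ^+ 2).
move=> *; lra.
Qed.

End Radius.

(** * Averaging over the random subsets of arms *)

Section Averaging.
Context (d : measure_display) (Omega : measurableType d) (R : realType).
Variables (P : probability Omega R) (k n : nat) (p : 'I_n.+1 -> R).
Variable X : 'I_k -> 'I_n.+1 -> nat -> {RV P >-> R}.
Hypothesis banditX : bandit p X.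
Variables (b : 'I_n.+1) (a q : R) (T : nat).
Hypothesis best : unique_best p b.
Hypothesis k_gt0 : (0 < k)%N.
Hypotheses (T_gt0 : (0 < T)%N) (a_ge1 : 1 <= a) (q01 : 0 <= q <= 1).

Notation radius := (ucb_radius n.+1 a).
Notation T1 := (explore T).
Let tau i := pull_count n.+1 a (p b - p i).

Lemma gap01 i : i != b -> 0 < p b - p i <= 1.
Proof.
move=> ib; have [_ pb1] := andP (mean01 banditX (Ordinal k_gt0) b).
have [pi0 _] := andP (mean01 banditX (Ordinal k_gt0) i).
by have := best ib; apply: contraTT; rewrite negb_and -!leNgt -ltNge; lra.
Qed.

(* Sets in which UCB pulls [b] more often than all the other arms together. *)
Definition light (u : {ffun 'I_n.+1 -> bool}) : bool :=
  u b && [forall i, (i != b) && u i ==>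
           (\sum_(l | (l != b) && u l) tau l *+ 2 < T1%:R)].

Let tau_ge1 i : i != b -> 1 <= tau i.
Proof. by move=> ib; apply: pull_count_ge1 => //; exact: gap01. Qed.

Lemma light_vote u j w : light u -> confident p X radius T1 j w ->
  vote u (play (ucb_pull radius u) (fun i s => X j i s w) T1) = b.
Proof.
move=> /andP[ub /forallP light_u] /forallP conf.
apply: (@vote_best _ _ radius u _ _ p tau b) => //.
- by move=> t; exact: ucb_radius_ge0.
- by move=> i s; case/andP: (reward_in01 banditX j i s w).
- by have /andP[] := mean01 banditX j b.
- by move=> i [//|t] /andP[_ tT]; exact: conf (i, Ordinal tT).
- by move=> i t ib t0; apply: ucb_radius_pull_count => //; exact: gap01.
- by move=> i ib ui; have := light_u i; rewrite ib ui.
Qed.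

Definition light_prob : R := \sum_u subset_law q u * (light u)%:R.

(** The slack between [T / 10] and [T / 6] absorbs the rounding in [explore], thanks to [x >= 1]. *)
Lemma explore_gt (x : R) : 1 <= x -> x <= T%:R / 10 -> x *+ 2 < T1%:R.
Proof.
move=> x1 xT; have : (T <= 3 * T1 + 2)%N by rewrite /explore; lia.
by rewrite -(ler_nat R) natrD natrM mulr2n; lra.
Qed.

Lemma light_sum (u : {ffun 'I_n.+1 -> bool}) : u b ->
  \sum_(l | (l != b) && u l) tau l <= T%:R / 10 -> light u.
Proof.
move=> ub le_sum; rewrite /light ub; apply/forallP => i; apply/implyP => /andP[ib ui].
rewrite sumrMnl; apply: explore_gt le_sum.
rewrite (bigD1 i) ?ib//= (le_trans (tau_ge1 ib))// lerDl; apply: sumr_ge0 => l.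
by move=> /andP[/andP[lb _] _]; rewrite (le_trans ler01)// tau_ge1.
Qed.

Lemma light_prob_le1 : light_prob <= 1.
Proof.
rewrite -(subset_law_sum1 n.+1 q); apply: ler_sum => u _.
by rewrite ler_piMr ?subset_law_ge0//; case: light.
Qed.

(** Markov's inequality: when [b] is drawn, the indicator of a load at most [T / 10] is at least 1
    minus [10 / T] times the load. In expectation [b] contributes [q], and each pair of [b] with
    another arm [q^2]. *)
Lemma light_prob_ge :
  q - 10 / T%:R * q ^+ 2 * \sum_(l | l != b) tau l <= light_prob.
Proof.
have T0 : 0 < T%:R :> R by rewrite ltr0n.
pose has (D : {set 'I_n.+1}) (u : {ffun 'I_n.+1 -> bool}) : R :=
  (D \subset [set i | u i]%SET)%:R.
apply: (@le_trans _ _ (\sum_u subset_law q u * (has [set b]%SET u -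
    10 / T%:R * \sum_(l | l != b) tau l * has [set b; l]%SET u))).
  under [leRHS]eq_bigr do rewrite mulrBr mulrCA mulr_sumr.
  rewrite sumrB subset_law_contains cards1 expr1 lerD2l lerN2 -mulr_sumr.
  rewrite -mulrA ler_pM2l ?divr_gt0// exchange_big /= mulr_sumr.
  apply: ler_sum => l lb; under eq_bigr do rewrite mulrCA.
  rewrite -mulr_sumr subset_law_contains cards2 eq_sym lb mulrC ler_pM2r//.
  by rewrite (lt_le_trans ltr01)// tau_ge1.
apply: ler_sum => u _; rewrite ler_wpM2l ?subset_law_ge0//.
have has1 : has [set b]%SET u = (u b)%:R by rewrite /has finset.sub1set inE.
have has2 l : has [set b; l]%SET u = (u b && u l)%:R.
  by rewrite /has finset.subUset !finset.sub1set !inE.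
rewrite has1; under eq_bigr do rewrite has2.
have [ub|_] := boolP (u b); last first.
  by rewrite big1 ?mulr0 ?subr0// => l _; rewrite mulr0.
rewrite (eq_bigr (fun l => if u l then tau l else 0)); last first.
  by move=> l _; case: (u l); rewrite ?mulr1 ?mulr0.
rewrite -big_mkcondr /=.
have [le_sum|gt_sum] := leP (\sum_(l | (l != b) && u l) tau l) (T%:R / 10).
  rewrite light_sum// gerBl mulr_ge0 ?divr_ge0//; apply: sumr_ge0 => l.
  by move=> /andP[lb _]; rewrite (le_trans ler01)// tau_ge1.
apply: le_trans (_ : 0 <= _) => //; rewrite subr_le0 -ler_pdivrMl ?divr_gt0//.
by rewrite mulr1 invf_div ltW.
Qed.

Lemma light_prob_ge_full : \sum_(l | l != b) tau l <= T%:R / 10 -> q <= light_prob.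
Proof.
move=> le_sum; rewrite -[leLHS](expr1) -(cards1 b) -subset_law_contains.
apply: ler_sum => u _; rewrite ler_wpM2l ?subset_law_ge0// finset.sub1set inE ler_nat.
case: (boolP (u b)) => // ub; rewrite light_sum//; apply: le_trans le_sum.
rewrite big_mkcondr; apply: ler_sum => l lb; case: ifP => // _.
by rewrite (le_trans ler01)// tau_ge1.
Qed.

Variable theta : R.
Hypothesis theta_ge0 : 0 <= theta.

(** The failure bound for fixed seeds is a product over players with independent seeds, each factor
    affine in the indicator of [light]; its average is a [k]-th power. *)
Lemma success_probability_ge (s : R) : 0 <= s ->
  ((1 - expR (s * theta) *
        (1 - light_prob * ((1 - expR (- a) *+ 2) * (1 - expR (- s)))) ^+ k
    - misleading_bound p theta T1 (T - T1) b)%:E <=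
   @success_probability R k n.+1 2 (two_phase k n radius theta T q01) T _ _ P X b)%E.
Proof.
move=> s0; set kappa := _ * (1 - expR (- s)); set M := misleading_bound _ _ _ _ _.
have confP j : (P (confident p X radius T1 j @^-1` [set false]) <=
                (expR (- a) *+ 2)%:E)%E.
  apply: (confident_prob banditX) => [t|]; first exact: ucb_radius_ge0.
  exact: ucb_radius_tail.
rewrite /success_probability /=.
pose law (v : {ffun 'I_k -> {ffun 'I_n.+1 -> bool}}) := \prod_j subset_law q (v j).
have law_ge0 v : 0 <= law v by apply: prodr_ge0 => j _; exact: subset_law_ge0.
apply: (@le_trans _ _ (\sum_v (law v *
  (1 - expR (s * theta) * (\prod_j (1 - (light (v j))%:R * kappa)) - M))%:E)%E).
  rewrite sumEFin lee_fin.
  have law_sum : \sum_v law v = 1.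
    rewrite -(bigA_distr_bigA (fun=> subset_law q)) /= big1// => j _.
    exact: subset_law_sum1.
  have prod_sum : \sum_v law v * \prod_j (1 - (light (v j))%:R * kappa) =
      (1 - light_prob * kappa) ^+ k.
    under eq_bigr do rewrite -big_split /=.
    rewrite -(bigA_distr_bigA (fun _ u =>
      subset_law q u * (1 - (light u)%:R * kappa))) /= prodr_const card_ord.
    congr (_ ^+ _); under eq_bigr do rewrite mulrBr mulr1 mulrA.
    by rewrite sumrB subset_law_sum1 -mulr_suml.
  rewrite (eq_bigr (fun v => law v - expR (s * theta) *
    (law v * \prod_j (1 - (light (v j))%:R * kappa)) - law v * M)); last first.
    by move=> v _; ring.
  by rewrite !sumrB -mulr_sumr -mulr_suml law_sum prod_sum mul1r.
apply: lee_sum => v _; rewrite EFinM lee_wpmul2l ?lee_fin//.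
apply: (@success_event_prob _ _ _ _ _ _ _ _ banditX b radius theta _ T best
  theta_ge0 T_gt0 light light_vote confP v q q01 (Ordinal k_gt0)) => //.
Qed.

End Averaging.

(** * The two regimes *)

Section Estimates.
Variable R : realType.

Lemma expR2_ge4 : 4 <= expR 2 :> R.
Proof.
have : 2 <= expR 1 :> R by have := @expR_ge1Dx R 1; lra.
have -> : (2 : R) = 1 + 1 by lra.
rewrite expRD; nra.
Qed.

Lemma expRN1_le : expR (- 1) <= 1 / 2 :> R.
Proof.
rewrite expRN div1r lef_pV2 ?posrE ?expR_gt0//.
have := @expR_ge1Dx R 1; lra.
Qed.

Lemma ln_ge_half (N : nat) : (1 < N)%N -> 1 / 2 <= ln N%:R :> R.
Proof.
move=> N1; have N0 : 0 < N%:R :> R by rewrite ltr0n (ltn_trans _ N1).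
have := @le_ln1Dx R (N%:R^-1 - 1).
rewrite [1 + (_ - 1)]addrC subrK lnV ?posrE//.
have : N%:R^-1 <= 1 / 2 :> R.
  by rewrite div1r lef_pV2 ?posrE// ler_nat.
have : 0 < N%:R^-1 :> R by rewrite invr_gt0.
by move=> h1 h2 h3; have := h3 ltac:(lra); lra.
Qed.

Variables (k : nat) (L r rho : R).
Hypotheses (L1 : 1 <= L) (r1 : 1 <= r) (r2 : r * r = k%:R) (rho1 : rho <= 1).

(** The bracket after [rho] is at least 1/4, so the base is at most [expR (- (2 / r))]. With
    [k = r^2] the whole is at most [expR (r - 2 r)], and [r >= 16 L]. *)
Lemma few_good_bound_many : 16 * L <= r -> 8 / r <= rho ->
  expR (1 * r) * (1 - rho * ((1 - expR (- 2) *+ 2) * (1 - expR (- 1)))) ^+ k <=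
  expR (- (4 * L)).
Proof.
move=> rL rho_ge; have e1 := expRN1_le.
have e2 : expR (- 2) <= 1 / 4 :> R.
  rewrite expRN div1r lef_pV2 ?posrE ?expR_gt0//.
  by have := expR2_ge4; lra.
have e10 := expR_ge0 (- 1 : R); have e20 := expR_ge0 (- 2 : R).
set kappa := _ * (1 - expR (- 1)).
have kappa_ge : 1 / 4 <= kappa.
  rewrite /kappa mulr2n; move: (expR (- 2)) (expR (- 1)) e1 e2 e10 e20 => y z; nra.
have kappa_le : kappa <= 1.
  rewrite /kappa mulr2n; move: (expR (- 2)) (expR (- 1)) e1 e2 e10 e20 => y z; nra.
have rho0 : 0 <= rho by rewrite (le_trans _ rho_ge)// divr_ge0// (le_trans ler01).
have base0 : 0 <= 1 - rho * kappa.
  by rewrite subr_ge0 mulr_ile1// (le_trans _ kappa_ge)// divr_ge0.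
have base_le : 1 - rho * kappa <= expR (- (2 / r)).
  apply: le_trans (expR_ge1Dx _); rewrite lerD2l lerN2.
  have : 2 / r = 8 / r * (1 / 4) by field; rewrite gt_eqF// (lt_le_trans ltr01).
  by move=> ->; apply: ler_pM => //; rewrite divr_ge0// (le_trans ler01).
apply: (@le_trans _ _ (expR (1 * r) * expR (- (2 / r)) ^+ k)).
  by rewrite ler_wpM2l ?expR_ge0// lerXn2r// nnegrE expR_ge0.
rewrite -expRM_natl -expRD ler_expR -r2 mul1r.
have -> : r + r * r * - (2 / r) = - r.
  by field; rewrite gt_eqF// (lt_le_trans ltr01).
by have := L1; rewrite lerN2; lra.
Qed.

(** The base is at most [4 expR (- s)], hence at most [expR (2 - s)]. The total exponent is
    [2 r^2 - 64 L r], at most [- 32 L r] since [r <= 16 L]. *)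
Lemma few_good_bound_few (s := 128 * L / r) : r <= 16 * L -> 1 <= rho ->
  expR (s * (k%:R / 2)) *
    (1 - rho * ((1 - expR (- s) *+ 2) * (1 - expR (- s)))) ^+ k <=
  expR (- (4 * L)).
Proof.
move=> rL rho_ge; have r0 : 0 < r by rewrite (lt_le_trans ltr01).
have L1' := L1; have s8 : 8 <= s by rewrite /s ler_pdivlMr//; lra.
have es0 := expR_ge0 (- s).
have es1 : expR (- s) <= 1 / 4.
  rewrite expRN div1r lef_pV2 ?posrE ?expR_gt0//.
  by apply: le_trans (_ : 1 + s <= _); [lra|exact: expR_ge1Dx].
have -> : rho = 1 by apply/le_anti; rewrite rho1.
have base0 : 0 <= 1 - 1 * ((1 - expR (- s) *+ 2) * (1 - expR (- s))).
  by rewrite mulr2n; nra.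
have base_le : 1 - 1 * ((1 - expR (- s) *+ 2) * (1 - expR (- s))) <= expR (2 - s).
  by rewrite expRD; have := expR2_ge4; rewrite mulr2n; nra.
apply: (@le_trans _ _ (expR (s * (k%:R / 2)) * expR (2 - s) ^+ k)).
  by rewrite ler_wpM2l ?expR_ge0// lerXn2r// nnegrE expR_ge0.
rewrite -expRM_natl -expRD ler_expR -r2 /s.
have -> : 128 * L / r * (r * r / 2) + r * r * (2 - 128 * L / r) =
          2 * (r * r) - 64 * (L * r).
  by field; rewrite gt_eqF.
have rr : r * r <= 16 * L * r by rewrite ler_pM2r.
have : L <= L * r by rewrite ler_peMr// (le_trans ler01).
move: rr; rewrite -mulrA; move: (L * r) (r * r) => y z; lra.
Qed.

End Estimates.

Lemma exploit_ge T : (T <= (T - explore T - explore T) * 3)%N.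
Proof. by rewrite /explore; lia. Qed.

(** * Constants and the budget *)

Section Main.
Context (d : measure_display) (Omega : measurableType d) (R : realType).
Variables (P : probability Omega R) (k n : nat) (p : 'I_n.+1 -> R).
Variable X : 'I_k -> 'I_n.+1 -> nat -> {RV P >-> R}.
Hypothesis banditX : bandit p X.
Variables (b : 'I_n.+1) (delta : R) (T : nat).
Hypotheses (best : unique_best p b) (k_gt0 : (0 < k)%N) (n_gt0 : (0 < n)%N).

Let L : R := log_inv delta.
Let r : R := Num.sqrt k%:R.
Let h i : R := ((p b - p i) ^+ 2)^-1 * ln (n.+1%:R / (p b - p i)).
Let H : R := \sum_(i | i != b) h i.

Variable C : R.
Hypothesis C_eq : C = 10 ^+ 7.

Let C_gt0 : 0 < C. Proof. by rewrite C_eq exprn_gt0. Qed.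

Hypothesis budget : C * pull_bound k delta p b <= T%:R.

Let gap i := gap01 banditX best k_gt0 (i := i).

Lemma log_inv_ge1 : 1 <= log_inv delta.
Proof. by rewrite /log_inv le_max lexx. Qed.

Let L1 : 1 <= L := log_inv_ge1.

Let r1 : 1 <= r.
Proof. by rewrite -sqrtr1 ler_sqrt// ler1n. Qed.

Let r2 : r * r = k%:R. Proof. by rewrite -expr2 sqr_sqrtr. Qed.

Let lnN : 1 / 2 <= ln (n.+1%:R : R).
Proof. exact: ln_ge_half. Qed.

Lemma ln_gap i : i != b -> ln n.+1%:R <= ln (n.+1%:R / (p b - p i)).
Proof.
move=> ib; have /andP[g0 g1] := gap ib.
by rewrite ln_div ?posrE// lerDl oppr_ge0 ln_le0.
Qed.

Let h_gt0 i : i != b -> 1 / 2 <= h i.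
Proof.
move=> ib; have /andP[g0 g1] := gap ib; have := ln_gap ib.
rewrite /h; move: (ln (_ / _)) lnN => y.
have : 1 <= ((p b - p i) ^+ 2)^-1 by rewrite invf_ge1 ?exprn_gt0//; nra.
nra.
Qed.

Let h_le i : i != b -> h i <= H.
Proof.
move=> ib; rewrite /H (bigD1 i)//= lerDl; apply: sumr_ge0 => l /andP[lb _].
by apply: le_trans (h_gt0 lb).
Qed.

Let H_gt0 : 1 / 2 <= H.
Proof.
have [i ib] : exists i, i != b.
  have [->|b0] := eqVneq b ord0; last by exists ord0; rewrite eq_sym.
  by exists ord_max; rewrite -val_eqE /= -lt0n.
exact: le_trans (h_gt0 ib) (h_le ib).
Qed.

Lemma budgetE : C * (H * L) <= T%:R * r.
Proof.
have r0 : 0 < r by rewrite (lt_le_trans ltr01).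
rewrite -ler_pdivrMr//; apply: le_trans budget.
have -> : pull_bound k delta p b = H * L / r.
  by rewrite /pull_bound -mulr_suml mulrC.
by rewrite [leRHS]mulrA.
Qed.

Let T_gt0 : (0 < T)%N.
Proof.
rewrite lt0n; apply/eqP => T0; have := budgetE; rewrite T0 mul0r leNgt.
have H0 : 0 < H by apply: lt_le_trans H_gt0; rewrite divr_gt0.
have L0 : 0 < L by apply: lt_le_trans L1.
by apply/negP; rewrite negbK; apply: mulr_gt0 => //; apply: mulr_gt0.
Qed.

(** The sample count [theta * M] is at least [(r / 2) (T / 3)], so the budget makes each exponent at
    least [10 L ln (n+1)]; the logarithm in the budget pays for the union over arms. *)
Lemma misleading_bound_le theta : r / 2 <= theta ->
  misleading_bound p theta (explore T) (T - explore T) b <= expR (- (4 * L)).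
Proof.
move=> theta_ge; set M := (T - explore T - explore T)%N.
have M_ge : T%:R / 3 <= M%:R :> R.
  by rewrite ler_pdivrMr// -natrM ler_nat exploit_ge.
have T0 : 0 <= T%:R / 3 :> R by rewrite divr_ge0.
apply: (@le_trans _ _ (\sum_(i : 'I_n.+1) expR (- (10 * (L * ln n.+1%:R))) *+ 2)).
  rewrite /misleading_bound big_mkcond; apply: ler_sum => i _.
  case: ifP => [ib|_]; last by rewrite mulrn_wge0// expR_ge0.
  rewrite ler_wMn2r// ler_expR lerN2.
  have /andP[g0 g1] := gap ib.
  have D20 : 0 < (p b - p i) ^+ 2 by rewrite exprn_gt0.
  have hD : h i * (p b - p i) ^+ 2 = ln (n.+1%:R / (p b - p i)).
    by rewrite /h mulrAC mulVf ?gt_eqF// mul1r.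
  have lng := ln_gap ib.
  have thetaM : C / 6 * (h i * L) <= theta * M%:R.
    apply: (@le_trans _ _ (r / 2 * (T%:R / 3))); last first.
      by apply: ler_pM => //; rewrite divr_ge0// (le_trans ler01).
    have : C * (h i * L) <= C * (H * L).
      by rewrite ler_pM2l// ler_wpM2r ?h_le// (le_trans ler01).
    by have := budgetE; lra.
  have step : C / 6 * (L * ln (n.+1%:R / (p b - p i))) <=
              theta * M%:R * (p b - p i) ^+ 2.
    rewrite -hD (_ : C / 6 * _ = C / 6 * (h i * L) * (p b - p i) ^+ 2); last ring.
    by rewrite ler_pM2r.
  have : L * ln n.+1%:R <= L * ln (n.+1%:R / (p b - p i)).
    by rewrite ler_wpM2l// (le_trans ler01).
  have : 0 <= L * ln n.+1%:R by rewrite mulr_ge0 ?(le_trans _ L1)// (le_trans _ lnN).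
  move: step; rewrite C_eq; move: (L * _) (L * _) => y z; lra.
have N0 : 0 < n.+1%:R :> R by rewrite ltr0n.
rewrite sumr_const card_ord -[leLHS]mulr_natl mulr2n -[leRHS]mul1r.
(* The [n+1] terms and the factor [2 <= n+1] cost [2 ln (n+1)] in the exponent; the remaining
   [8 L ln (n+1)] is at least [4 L]. *)
apply: (@le_trans _ _ (expR (ln n.+1%:R) * (expR (ln n.+1%:R) *
    expR (- (10 * (L * ln n.+1%:R)))))).
  rewrite lnK ?posrE// ler_pM2l// -mulr2n -[leLHS]mulr_natl.
  by rewrite ler_wpM2r ?expR_ge0// ler_nat.
rewrite -!expRD mul1r ler_expR.
have : ln n.+1%:R <= L * ln n.+1%:R.
  by rewrite ler_peMl// (le_trans _ lnN)// divr_ge0.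
have : L * (1 / 2) <= L * ln n.+1%:R by rewrite ler_wpM2l// (le_trans ler01).
by move: (ln _) (L * ln _) => y z; lra.
Qed.

Lemma tau_sum_le a c : 0 <= c -> a <= c * ln n.+1%:R ->
  \sum_(i | i != b) pull_count n.+1 a (p b - p i) <= 10 ^+ 3 * (c + 1) * H.
Proof.
move=> c0 ac; rewrite /H mulr_sumr; apply: ler_sum => i ib.
have /andP[g0 g1] := gap ib; have lng := ln_gap ib.
rewrite /pull_count /h [leRHS](_ : _ =
    10 ^+ 3 * ((c + 1) * ln (n.+1%:R / (p b - p i))) / (p b - p i) ^+ 2); last first.
  by move: (10 ^+ 3) => K; rewrite -!mulrA; congr (_ * (_ * _)); rewrite mulrC.
rewrite ler_pM2r ?invr_gt0 ?exprn_gt0// ler_pM2l// mulrDl mul1r lerD2r.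
by rewrite (le_trans ac)// ler_wpM2l.
Qed.

(** One factor [expR (- L)] is at most [delta], and the remaining [expR (- (3 * L))] pays for there
    being two kinds of failure. *)
Lemma total_failure : expR (- (4 * L)) + expR (- (4 * L)) <= delta \/ delta <= 0.
Proof.
have [d0|d0] := leP delta 0; [by right|left].
have : expR (- L) <= delta.
  rewrite -[leRHS]lnK ?posrE// ler_expR -[leRHS]opprK -lnV ?posrE// lerN2.
  by rewrite /L /log_inv le_max lexx orbT.
apply: le_trans.
have -> : - (4 * L) = - L + - (3 * L) by lra.
rewrite expRD; have := expR_ge0 (- L).
have : expR (- (3 * L)) <= 1 / 2.
  by apply: le_trans (expRN1_le R); rewrite ler_expR; have := L1; lra.
by move: (expR (- L)) (expR _) => y z; nra.
Qed.

Lemma success_many (q := 16 / r) (q01 : 0 <= q <= 1) : 0 < delta ->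
  16 * L <= r ->
  ((1 - delta)%:E <= @success_probability R k n.+1 2
     (two_phase k n (ucb_radius n.+1 2) r T q01) T _ _ P X b)%E.
Proof.
move=> d0 rL; have r0 : 0 < r by rewrite (lt_le_trans ltr01).
have [L1' lnN' H0] := And3 L1 lnN H_gt0.
have a1 : 1 <= 2 :> R by lra.
apply: le_trans (success_probability_ge banditX best k_gt0 T_gt0 a1 q01 (ltW r0) ler01).
rewrite lee_fin.
have M_le := @misleading_bound_le r ltac:(lra).
have Tr : 0 < T%:R :> R by rewrite ltr0n.
have rho_ge : 8 / r <= light_prob p b 2 q T.
  apply: le_trans (light_prob_ge banditX best k_gt0 T_gt0 a1 q01).
  (* Here [a = 2] is at most [4 ln (n+1)], so the total load is at most [5000 H]. *)
  have S_le := @tau_sum_le 2 4 ltac:(lra) ltac:(lra).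
  set S := \sum_(l | _) _ in S_le *.
  (* The Markov loss is at most half of [q = 16 / r], which leaves [8 / r]. *)
  have : 10 / T%:R * q ^+ 2 * S <= q / 2.
    have q0 : 0 <= q by case/andP: q01.
    rewrite expr2 mulrA (_ : _ * q * q * S = q * (10 / T%:R * q * S)); last ring.
    rewrite ler_wpM2l// /q (_ : _ * _ = 160 * S / (T%:R * r)); last first.
      by field; rewrite !gt_eqF.
    rewrite ler_pdivrMr ?mulr_gt0//; have := budgetE; rewrite C_eq.
    have : H <= H * L by rewrite ler_peMr// (le_trans _ H_gt0).
    lra.
  rewrite (_ : 8 / r = q - q / 2); first lra.
  by rewrite /q; field; rewrite gt_eqF.
have rho1 := light_prob_le1 p b 2 T q01.
have := few_good_bound_many L1 r1 r2 rho1 rL rho_ge.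
case: total_failure; last by rewrite leNgt d0.
lra.
Qed.

Lemma success_few (s := 128 * L / r) (q01 : 0 <= (1 : R) <= 1) : 0 < delta ->
  r <= 16 * L ->
  ((1 - delta)%:E <= @success_probability R k n.+1 2
     (two_phase k n (ucb_radius n.+1 s) (k%:R / 2) T q01) T _ _ P X b)%E.
Proof.
move=> d0 rL; have r0 : 0 < r by rewrite (lt_le_trans ltr01).
have [L1' lnN' H0] := And3 L1 lnN H_gt0.
have s8 : 8 <= s by rewrite /s ler_pdivlMr//; lra.
have s1 : 1 <= s by lra.
have theta0 : 0 <= k%:R / 2 :> R by rewrite divr_ge0.
have s0 : 0 <= s by lra.
apply: le_trans (success_probability_ge banditX best k_gt0 T_gt0 s1 q01 theta0 s0).
rewrite lee_fin.
have M_le : misleading_bound p (k%:R / 2) (explore T) (T - explore T) b <= expR (- (4 * L)).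
  apply: misleading_bound_le; rewrite ler_pM2r// -[leRHS](sqr_sqrtr (ler0n _ k)) -/r.
  by rewrite expr2 ler_peMl// ltW.
have rho_ge : 1 <= light_prob p b s 1 T.
  apply: (light_prob_ge_full banditX best k_gt0 T_gt0 s1 q01).
  have c0 : 0 <= 256 * L / r by rewrite divr_ge0 ?mulr_ge0 ?ltW// (lt_le_trans ltr01).
  have sc : s <= 256 * L / r * ln n.+1%:R.
    have y0 : 0 <= L / r by apply: divr_ge0; [exact: le_trans ler01 L1|exact: ltW].
    have := lnN; rewrite /s -!(mulrA _ L); move: (L / r) y0 (ln _) => y y0 z; nra.
  apply: le_trans (tau_sum_le c0 sc) _.
  (* Since [r <= 16 L], the [+ 1] of [tau_sum_le] is itself a multiple of [L / r], the scale of the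
     per-player budget. *)
  have one_le : 1 <= 16 * (L / r) by rewrite mulrA ler_pdivlMr// mul1r.
  have HLr : C * (H * (L / r)) <= T%:R.
    by have := budgetE; rewrite -ler_pdivrMr// !mulrA.
  rewrite -(mulrA _ L); move: HLr one_le; rewrite C_eq [H * _]mulrC.
  move: (L / r) H_gt0 => y H1 HLr y1; nra.
have rho1 := light_prob_le1 p b s T q01.
have := few_good_bound_few L1 r1 r2 rho1 rL rho_ge.
case: total_failure; last by rewrite leNgt d0.
rewrite -/s; lra.
Qed.

End Main.

Lemma two_phase_measurable (R : realType) (k n : nat) (radius : nat -> R)
    (q theta : R) (T : nat) (q01 : 0 <= q <= 1) (d : measure_display)
    (Omega : measurableType d) (P : probability Omega R)
    (X : 'I_k -> 'I_n.+1 -> nat -> {RV P >-> R}) (b : 'I_n.+1)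
    (u : {ffun 'I_k -> {ffun 'I_n.+1 -> bool}}) :
  (0 < k)%N ->
  measurable (@success_event R k n.+1 2 (two_phase k n radius theta T q01)
    T _ _ P X b u).
Proof.
by move=> k_gt0; apply: measurable_success_event (Ordinal k_gt0) _ _.
Qed.

Lemma one_arm (R : realType) (k m T : nat) (alg : algorithm R k 1 m)
    (d : measure_display) (Omega : measurableType d) (P : probability Omega R)
    (X : 'I_k -> 'I_1 -> nat -> {RV P >-> R}) (b : 'I_1) :
  success_probability alg T X b = 1%E.
Proof.
have succ u : success_event (alg := alg) T X b u = setT.
  by apply/seteqP; split => // w _ j; rewrite [LHS]ord1 [RHS]ord1.
rewrite /success_probability; under eq_bigr do rewrite succ probability_setT mule1.
rewrite sumEFin -(bigA_distr_bigA (@seed_law _ _ _ _ alg)) /=.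
by rewrite big1// => j _; exact: seed_law_sum1.
Qed.

Theorem theorem3p2 (R : realType) :
  exists Cpull Cmsg : R, 0 < Cpull /\ 0 < Cmsg /\
  forall (k n : nat) (delta : R) (T : nat),
    (1 <= k)%N -> (1 <= n)%N -> 0 < delta ->
    exists (m : nat) (alg : algorithm R k n m),
      m%:R <= Cmsg * log_inv delta /\
      forall (d : measure_display) (Omega : measurableType d)
             (P : probability Omega R)
             (X : 'I_k -> 'I_n -> nat -> {RV P >-> R})
             (p : 'I_n -> R) (b : 'I_n),
        bandit p X -> unique_best p b ->
        Cpull * pull_bound k delta p b <= T%:R ->
        (forall u : {ffun 'I_k -> seed alg},
           measurable (success_event T X b u)) /\
        ((1 - delta)%:E <= success_probability alg T X b)%E.
Proof.
(* Two values per player suffice for every [delta], since [log_inv delta >= 1]. *)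
exists (10 ^+ 7), 2; split; first by rewrite exprn_gt0.
split=> // k [//|n] delta T k_gt0 _ d0; exists 2.
have L1 := log_inv_ge1 delta.
have msg : 2 <= 2 * log_inv delta by rewrite ler_peMr.
pose L := log_inv delta; pose r : R := Num.sqrt k%:R.
(* With a single arm the pull bound is an empty sum and [T] may be 0, but every decision is then
   correct. *)
have [n0|n_gt0] := posnP n.
  subst n; have q01 : 0 <= (1 : R) <= 1 by rewrite ler01 lexx.
  exists (two_phase k 0 (ucb_radius 1 1) 0 T q01); split => // d Omega P X p b _ _ _.
  split; first by move=> u; exact: two_phase_measurable.
  by rewrite one_arm lee_fin gerBl ltW.
have [rL|rL] := leP (16 * L) r.
  have q01 : 0 <= 16 / r <= 1.
    have r0 : 0 < r by rewrite (lt_le_trans _ rL)// mulr_gt0// (lt_le_trans ltr01).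
    apply/andP; split; first by apply: divr_ge0 => //; exact: ltW.
    by rewrite ler_pdivrMr// mul1r (le_trans _ rL)// ler_peMr.
  exists (two_phase k n (ucb_radius n.+1 2) r T q01).
  split => // d Omega P X p b bX best budget.
  split; first by move=> u; exact: two_phase_measurable.
  exact: (success_many bX best k_gt0 n_gt0 erefl budget q01 d0 rL).
have q01 : 0 <= (1 : R) <= 1 by rewrite ler01 lexx.
exists (two_phase k n (ucb_radius n.+1 (128 * L / r)) (k%:R / 2) T q01).
split => // d Omega P X p b bX best budget.
split; first by move=> u; exact: two_phase_measurable.
exact: (success_few bX best k_gt0 n_gt0 erefl budget q01 d0 (ltW rL)).
Qed.
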